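(* Every absolute-valued algebra $A$ with left-unit satisfying $(x^2, x^2, x^2) = 0$ is finite-dimensional of degree $\leq 4$. Concretely: (1) If $\deg(A) \leq 2$, then $A$ is isomorphic to either $\mathbb{R}$, $\mathbb{C}$, ${}^*\mathbb{C}$, $\mathbb{H}$, ${}^*\mathbb{H}$, $\mathbb{O}$ or ${}^*\mathbb{O}$. (2) If $\deg(A) = 4$, then $A$ is isomorphic to either ${}^*\mathbb{H}(i, 1)$, ${}^*\mathbb{O}(i, 1)$, $\tilde{\mathbb{O}}$ or $\tilde{\mathbb{O}}(i)$.
   Context: An absolute-valued algebra is a nonzero real algebra $A$ with a space norm $\|\cdot\|$ such that $\|xy\| = \|x\|\,\|y\|$ for all $x,y\in A$; $(x,y,z) = (xy)z - x(yz)$ denotes the associator. A left-unit is an element $e$ with $ex = x$ for all $x$. The degree of a finite-dimensional algebra is the smallest $n$ such that every subalgebra generated by a single element has dimension $\leq n$. For $\mathbb{A}\in\{\mathbb{C},\mathbb{H},\mathbb{O}\}$ (complexes, quaternions, octonions) with standard involution $x\mapsto\bar{x}$, ${}^*\mathbb{A}$ denotes the normed space of $\mathbb{A}$ with product $x\odot y = \bar{x}y$. ${}^*\mathbb{H}(i,1)$ is the normed space $\mathbb{H}$ with product $x\odot y = \bar{x}\, i\, y$. ${}^*\mathbb{O}(i,1)$ is the normed space $\mathbb{O}$ with product $x\odot y = (\bar{x} i)y$. On $\mathbb{H}\times\mathbb{H}$ let $\bullet$ be the Cayley–Dickson product $(x,y)\bullet(u,v) = (xu - \bar{v}y,\; y\bar{u}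 + vx)$ (so $(\mathbb{H}\times\mathbb{H},\bullet)=\mathbb{O}$). $\tilde{\mathbb{O}}$ is $\mathbb{H}\times\mathbb{H}$ with product $(x,y)\odot(u,v) = (\bar{x}, y)\bullet(u,v)$, and $\tilde{\mathbb{O}}(i)$ is $\mathbb{H}\times\mathbb{H}$ with product $(x,y)\odot(u,v) = (i\bar{x}\bar{i},\; iyi)\bullet(u,v)$; both have left-unit $(1,0)$. *)

(* Defs.v *)
From mathcomp Require Import all_boot all_order all_algebra.
From mathcomp Require Import reals.
Set Implicit Arguments. Unset Strict Implicit. Unset Printing Implicit Defensive.
Import Order.TTheory GRing.Theory Num.Theory.
Local Open Scope ring_scope.

Section AVA.
Variables (R : realType) (V : lmodType R).

Definition bilinear_prod (mul : V -> V -> V) : Prop :=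
  (forall (a : R) (x y z : V), mul (a *: x + y) z = a *: mul x z + mul y z) /\
  (forall (a : R) (x y z : V), mul z (a *: x + y) = a *: mul z x + mul z y).

Definition is_norm (nrm : V -> R) : Prop :=
  (forall x, nrm x = 0 -> x = 0) /\
  (forall (a : R) x, nrm (a *: x) = `|a| * nrm x) /\
  (forall x y, nrm (x + y) <= nrm x + nrm y).

Definition absolute_valued_algebra (mul : V -> V -> V) (nrm : V -> R) : Prop :=
  (exists x : V, x != 0) /\ bilinear_prod mul /\ is_norm nrm /\
  (forall x y, nrm (mul x y) = nrm x * nrm y).

Definition left_unit (mul : V -> V -> V) (e : V) : Prop := forall x, mul e x = x.

Definition associator (mul : V -> V -> V) (x y z : V) : V :=
  mul (mul x y) z - mul x (mul y z).

Definition in_span (n : nat) (f : 'I_n -> V) (v : V) : Prop :=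
  exists c : 'I_n -> R, v = \sum_(i < n) c i *: f i.

Definition finite_dimensional : Prop :=
  exists (n : nat) (f : 'I_n -> V), forall v, in_span f v.

Definition subalgebra (mul : V -> V -> V) (S : V -> Prop) : Prop :=
  S 0 /\ (forall (a : R) x y, S x -> S y -> S (a *: x + y)) /\
  (forall x y, S x -> S y -> S (mul x y)).

Definition gen_subalg (mul : V -> V -> V) (x : V) : V -> Prop :=
  fun v => forall S, subalgebra mul S -> S x -> S v.

Definition dim_le (S : V -> Prop) (n : nat) : Prop :=
  exists f : 'I_n -> V, (forall i, S (f i)) /\ (forall v, S v -> in_span f v).

Definition deg_le (mul : V -> V -> V) (n : nat) : Prop :=
  forall x, dim_le (gen_subalg mul x) n.

Definition deg_eq (mul : V -> V -> V) (n : nat) : Prop :=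
  deg_le mul n /\ forall m, deg_le mul m -> (n <= m)%N.

End AVA.

Definition alg_iso (R : realType) (V W : lmodType R)
  (mulV : V -> V -> V) (mulW : W -> W -> W) : Prop :=
  exists f : V -> W,
    (forall (a : R) x y, f (a *: x + y) = a *: f x + f y) /\ bijective f /\
    (forall x y, f (mulV x y) = mulW (f x) (f y)).

(** Cayley--Dickson doubling with the paper's convention
    (x,y)(u,v) = (xu - v* y, y u* + v x),  (x,y)* = (x*, -y). *)
Definition cd_mul (A : zmodType) (m : A -> A -> A) (c : A -> A)
  (p q : A * A) : A * A :=
  (m p.1 q.1 - m (c q.2) p.2, m p.2 (c q.1) + m q.2 p.1).
Definition cd_conj (A : zmodType) (c : A -> A) (p : A * A) : A * A :=
  (c p.1, - p.2).

Section Models.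
Variable R : realType.

Definition Rr : lmodType R := R^o.
Definition Rmul (x y : Rr) : Rr := (x : R) * y.
Definition Cc : lmodType R := (R^o * R^o)%type.
Definition Cmul : Cc -> Cc -> Cc := @cd_mul R^o Rmul id.
Definition Cconj : Cc -> Cc := @cd_conj R^o id.
Definition Hh : lmodType R := (Cc * Cc)%type.
Definition Hmul : Hh -> Hh -> Hh := @cd_mul Cc Cmul Cconj.
Definition Hconj : Hh -> Hh := @cd_conj Cc Cconj.
Definition Oo : lmodType R := (Hh * Hh)%type.
Definition Omul : Oo -> Oo -> Oo := @cd_mul Hh Hmul Hconj.
Definition Oconj : Oo -> Oo := @cd_conj Hh Hconj.

Definition Hi : Hh := ((0 : R^o, 1 : R^o), (0 : R^o, 0 : R^o)).
Definition Oi : Oo := (Hi, 0).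

Definition starCmul (x y : Cc) : Cc := Cmul (Cconj x) y.
Definition starHmul (x y : Hh) : Hh := Hmul (Hconj x) y.
Definition starOmul (x y : Oo) : Oo := Omul (Oconj x) y.
Definition starHi1mul (x y : Hh) : Hh := Hmul (Hmul (Hconj x) Hi) y.
Definition starOi1mul (x y : Oo) : Oo := Omul (Omul (Oconj x) Oi) y.
Definition Otildemul (p q : Oo) : Oo := Omul (Hconj p.1, p.2) q.
Definition Otildeimul (p q : Oo) : Oo :=
  Omul (Hmul (Hmul Hi (Hconj p.1)) (Hconj Hi), Hmul (Hmul Hi p.2) Hi) q.

End Models.

(* Main.v *)
(** Write R_e for right multiplication by the left unit e.  The first-order part
    of the identity at e + t y gives R_e^3 = R_e, hence R_e^2 = 1, so the product
    x o y = (x e) y is absolute-valued with two-sided unit e and x y = R_e(x) o y.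

    For a two-sided unit, elements of a plane containing e commute, whence
    |p + q| |p - q| = |p^2 - q^2| <= |p|^2 + |q|^2 there.  This forces the plane to be
    Euclidean: a parabola lying above the squared norm and touching it can only
    touch it on a set closed under angle bisection, hence everywhere.  It follows that
    x^2 = 2 t(x) x - |x|^2 e with t linear, the norm comes from an inner product, and
    Cayley-Dickson doubling identifies the unital algebra with R, C, H or O.

    The second-order part of the identity says that R_e fixes all squares.  On the
    orthogonal complement of e, with R_e-eigenspaces V+ and V-, this means
    V+ o V- <= V+.  If V- = 0 or V+ = 0 then R_e is the identity or the conjugation,
    of degree at most 2.  Otherwise, either V- is a line R i, R_e is the reflection
    in i, and w |-> - i w is an isomorphism from the algebra with product (x* i) y;
    or dim V- > 1, and then R e + V- is a quaternion algebra with orthogonal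
    complement V+, which is the first of the two tilde algebras. *)
Require Import Defs.
From mathcomp Require Import all_boot all_order all_algebra.
From mathcomp Require Import reals.
From mathcomp Require Import ring lra.
From mathcomp Require Import boolp classical_sets topology normedtype derive realfun.
Import Order.TTheory GRing.Theory Num.Theory.
Import numFieldNormedType.Exports.
Set Implicit Arguments. Unset Strict Implicit. Unset Printing Implicit Defensive.
Local Open Scope ring_scope.

(** * Linear identities in modules *)

Inductive lexp (R : Type) : Type :=
  | LVar of nat | LZero | LAdd of lexp R & lexp R | LOpp of lexp R
  | LScale of R & lexp R.
Arguments LVar {R}. Arguments LZero {R}.

Section ModuleReflection.
Variables (R : comPzRingType) (V : lmodType R).

Fixpoint lval (env : seq V) (e : lexp R) : V :=
  match e with
  | LVar n => env`_n
  | LZero => 0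
  | LAdd a b => lval env a + lval env b
  | LOpp a => - lval env a
  | LScale c a => c *: lval env a
  end.

(** Testing with [eqn] rather than [==] lets [lmod_coefs] evaluate coefficients by [cbv] on a short
    list of constants, leaving the scalars untouched for [ring] or [field]. *)
Fixpoint lcoef (e : lexp R) (i : nat) : R :=
  match e with
  | LVar n => if eqn n i then 1 else 0
  | LZero => 0
  | LAdd a b => lcoef a i + lcoef b i
  | LOpp a => - lcoef a i
  | LScale c a => c * lcoef a i
  end.

Lemma lvalE env e : lval env e = \sum_(i < size env) lcoef e i *: env`_i.
Proof.
elim: e => [n||a IHa b IHb|a IHa|c a IHa].
- have E i : lcoef (LVar n) i = (n == i)%:R by rewrite /= eqnE; case: eqP.
  case: (ltnP n (size env)) => hn.
    rewrite (bigD1 (Ordinal hn)) // big1; first by rewrite E eqxx scale1r /= addr0.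
    move=> i; rewrite andTb -(inj_eq val_inj) eq_sym E => /negbTE /= ->.
    exact: scale0r.
  rewrite /lval nth_default // big1 // => i _.
  by rewrite E (gtn_eqF (leq_trans (ltn_ord i) hn)) scale0r.
- by rewrite big1 // => i _; rewrite scale0r.
- by rewrite /= IHa IHb -big_split /=; apply: eq_bigr => i _; rewrite scalerDl.
- by rewrite /= IHa -sumrN; apply: eq_bigr => i _; rewrite scaleNr.
- by rewrite /= IHa scaler_sumr; apply: eq_bigr => i _; rewrite scalerA.
Qed.

Fixpoint lcoefs_eq (n : nat) (a b : lexp R) : Prop :=
  if n is m.+1 then lcoef a m = lcoef b m /\ lcoefs_eq m a b else True.

Lemma lval_eq env a b : lcoefs_eq (size env) a b -> lval env a = lval env b.
Proof.
move=> h; rewrite !lvalE; apply: eq_bigr => -[i hi] _ /=; congr (_ *: _).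
elim: (size env) h hi => //= n IHn [hn h]; rewrite ltnS leq_eqVlt.
by case/orP => [/eqP->//|]; exact: IHn.
Qed.

End ModuleReflection.

(** The inner [match] on [constr:(tt)] runs the test [constr_eq] while a term is being computed; its
    failure backtracks to the rest of [env]. *)
Ltac lindex v env :=
  lazymatch env with
  | cons ?w ?s => match constr:(tt) with
      | _ => let _ := match constr:(tt) with _ => constr_eq v w end in constr:(0%N)
      | _ => let n := lindex v s in constr:(S n) end
  end.
Ltac latoms t env :=
  lazymatch t with
  | ?a + ?b => let env1 := latoms a env in latoms b env1
  | - ?a => latoms a env
  | _ *: ?a => latoms a env
  | 0 => constr:(env)
  | _ => match constr:(tt) with
         | _ => let _ := lindex t env in constr:(env)
         | _ => constr:(cons t env) end
  end.
Ltac lreify R t env :=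
  lazymatch t with
  | ?a + ?b => let x := lreify R a env in let y := lreify R b env in
               constr:(@LAdd R x y)
  | - ?a => let x := lreify R a env in constr:(@LOpp R x)
  | ?c *: ?a => let x := lreify R a env in constr:(@LScale R c x)
  | 0 => constr:(@LZero R)
  | _ => let n := lindex t env in constr:(@LVar R n)
  end.

(* Reduces an equality between linear combinations in a module to equalities
   between the coefficients of each atom. *)
Ltac lmod_coefs :=
  lazymatch goal with
  | |- @eq ?T ?a ?b =>
    match goal with
    | V : GRing.Lmodule.type ?R |- _ =>
      unify T (GRing.Lmodule.sort V);
      let env0 := latoms a (@nil (GRing.Lmodule.sort V)) in
      let env := latoms b env0 in
      let ea := lreify (GRing.Nmodule.sort R) a env in
      let eb := lreify (GRing.Nmodule.sort R) b env in
      refine (@lval_eq _ V env ea eb _);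
      cbv beta iota delta [lcoefs_eq lcoef size eqn];
      repeat split
    end
  end.
Ltac lmod := lmod_coefs; ring.

(** * Coordinates in Cayley-Dickson algebras *)

Lemma pair_ext (S T : Type) (p q : S * T) : p.1 = q.1 -> p.2 = q.2 -> p = q.
Proof. by case: p q => [? ?] [? ?] /= -> ->. Qed.

(** Components are computed on syntax, one level of doubling at a time; [cd_ring] certifies the
    resulting polynomials with [change]. *)
Ltac cd_fst t :=
  lazymatch t with
  | cd_mul ?m ?c ?p ?q =>
    let p1 := cd_fst p in let p2 := cd_snd p in
    let q1 := cd_fst q in let q2 := cd_snd q in constr:(m p1 q1 - m (c q2) p2)
  | cd_conj ?c ?p => let p1 := cd_fst p in constr:(c p1)
  | ?a + ?b => let a1 := cd_fst a in let b1 := cd_fst b in constr:(a1 + b1)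
  | - ?a => let a1 := cd_fst a in constr:(- a1)
  | (?a, _) => constr:(a)
  | _ => constr:(t.1)
  end
with cd_snd t :=
  lazymatch t with
  | cd_mul ?m ?c ?p ?q =>
    let p1 := cd_fst p in let p2 := cd_snd p in
    let q1 := cd_fst q in let q2 := cd_snd q in constr:(m p2 (c q1) + m q2 p1)
  | cd_conj ?c ?p => let p2 := cd_snd p in constr:(- p2)
  | ?a + ?b => let a2 := cd_snd a in let b2 := cd_snd b in constr:(a2 + b2)
  | - ?a => let a2 := cd_snd a in constr:(- a2)
  | (_, ?b) => constr:(b)
  | _ => constr:(t.2)
  end.
(* Expands a component of an iterated Cayley-Dickson product into a real polynomial. *)
Ltac cd_norm R t :=
  lazymatch t with
  | fst ?u => let v := cd_norm R u in cd_fst v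
  | snd ?u => let v := cd_norm R u in cd_snd v
  | _ => constr:(t)
  end.
Ltac cd_real R t :=
  lazymatch t with
  | ?a + ?b => let a' := cd_real R a in let b' := cd_real R b in constr:(a' + b')
  | - ?a => let a' := cd_real R a in constr:(- a')
  | Rmul ?a ?b => let a' := cd_real R a in let b' := cd_real R b in constr:(a' * b')
  | id ?a => cd_real R a
  | 0 => constr:(0 : Num.RealField.sort R)
  | 1 => constr:(1 : Num.RealField.sort R)
  | _ =>
    let t' := cd_norm R t in
    lazymatch t' with
    | t => constr:(t : Num.RealField.sort R)
    | _ => cd_real R t'
    end
  end.
Ltac cd_ring :=
  rewrite ?/Omul ?/Oconj ?/Hmul ?/Hconj ?/Cmul ?/Cconj;
  repeat (apply: pair_ext);
  match goal with
  | R : Real.type |- ?a = ?b =>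
    let a := cd_real R a in let b := cd_real R b in
    change (a = b); ring
  end.
Lemma octonion_double_zero_divisor (R : realType) :
  exists p q : Oo R * Oo R,
    [/\ cd_mul (@Omul R) (@Oconj R) p q = 0, p <> 0 & q <> 0].
Proof.
pose z : Hh R := ((0, 0), (0, 0)); pose o : Rr R := 1.
(* With k = ij and l the unit of the second copy of the quaternions, the two factors are (i, j) and
   (l, -kl). *)
exists ((((0, o), (0, 0)), z), (((0, 0), (o, 0)), z)).
exists ((z, ((o, 0), (0, 0))), (z, ((0, 0), (0, - o)))).
split.
- have -> : 0 = ((z, z), (z, z)) :> Oo R * Oo R by [].
  rewrite /z /o; cd_ring.
- by move/(congr1 (fun p => p.1.1.1.2))/eqP; rewrite /= oner_eq0.
- by move/(congr1 (fun p => p.1.2.1.1))/eqP; rewrite /= oner_eq0.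
Qed.

(** Multiplication by i permutes the coordinates up to sign; this explicit form keeps the
    polynomials in [Omul_i_middle] small. *)
Lemma Omul_il (R : realType) (x : Oo R) : Omul (Oi R) x =
  (((- x.1.1.2, x.1.1.1), (- x.1.2.2, x.1.2.1)),
   ((- x.2.1.2, x.2.1.1), (x.2.2.2, - x.2.2.1))) :> Oo R.
Proof.
have -> : Oi R = (((0, 1), (0, 0)), ((0, 0), (0, 0))) by [].
case: x => [[[? ?] [? ?]] [[? ?] [? ?]]]; cd_ring.
Qed.
Lemma Omul_ir (R : realType) (x : Oo R) : Omul x (Oi R) =
  (((- x.1.1.2, x.1.1.1), (x.1.2.2, - x.1.2.1)),
   ((x.2.1.2, - x.2.1.1), (- x.2.2.2, x.2.2.1))) :> Oo R.
Proof.
have -> : Oi R = (((0, 1), (0, 0)), ((0, 0), (0, 0))) by [].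
case: x => [[[? ?] [? ?]] [[? ?] [? ?]]]; cd_ring.
Qed.
(** This is the left Moufang identity x(y(xz)) = (xyx)z at x = i, y = ai, z = -iv, checked in
    coordinates. *)
Lemma Omul_i_middle (R : realType) (a v : Oo R) :
  Omul (Oi R) (Omul (Omul a (Oi R)) v) = Omul (Omul (Oi R) a) (Omul (Oi R) v).
Proof.
case: a v => [[[? ?] [? ?]] [[? ?] [? ?]]] [[[? ?] [? ?]] [[? ?] [? ?]]].
rewrite !Omul_il Omul_ir; cd_ring.
Qed.

Lemma Hmul_i_middle (R : realType) (a v : Hh R) :
  Hmul (Hi R) (Hmul (Hmul a (Hi R)) v) = Hmul (Hmul (Hi R) a) (Hmul (Hi R) v).
Proof.
have -> : Hi R = ((0, 1), (0, 0)) by [].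
case: a v => [[? ?] [? ?]] [[? ?] [? ?]]; cd_ring.
Qed.

(** * A criterion for a normed plane to be Euclidean *)

(** The supremum of the zeros up to [t] is again a zero, because a Lipschitz function cannot be
    nonzero arbitrarily close to its zeros with a value bounded away from 0. *)
Lemma last_zero (R : realType) (h : R -> R) (t b : R) :
  (forall x y, `|h x - h y| <= 2 * `|x - y|) -> h b = 0 -> b <= t ->
  exists lo, [/\ h lo = 0, b <= lo, lo <= t & forall x, h x = 0 -> x <= t -> x <= lo].
Proof.
move=> hl hb bt; pose E := [set x | h x = 0 /\ x <= t]%classic.
have Esup : has_sup E by split; [exists b | exists t => x []].
have up x : h x = 0 -> x <= t -> x <= sup E.
  by move=> hx xt; apply: (sup_upper_bound Esup).
exists (sup E); split; [|exact: up| |exact: up]; last first.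
  by apply: ge_sup; [exists b | move=> x []].
apply/eqP; rewrite -normr_le0 leNgt; apply/negP => h0.
have e0 : 0 < `|h (sup E)| / 2 by rewrite divr_gt0.
have [x [hx xt] xlt] := sup_adherent e0 Esup.
have := hl (sup E) x; rewrite hx subr0 (ger0_norm (_ : 0 <= sup E - x)) ?subr_ge0 ?up //; lra.
Qed.

Lemma first_zero (R : realType) (h : R -> R) (t b : R) :
  (forall x y, `|h x - h y| <= 2 * `|x - y|) -> h b = 0 -> t <= b ->
  exists hi, [/\ h hi = 0, hi <= b, t <= hi & forall x, h x = 0 -> t <= x -> hi <= x].
Proof.
move=> hl hb bt.
have [|||lo [h1 h2 h3 h4]] := @last_zero R (fun x => h (- x)) (- t) (- b).
- move=> x y; have -> : x - y = - (- x - - y) by ring.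
  rewrite normrN; exact: hl.
- by rewrite opprK.
- by rewrite lerN2.
exists (- lo); split => //; [by rewrite lerNl | by rewrite lerNr |].
by move=> x hx tx; rewrite lerNl; apply: h4; rewrite ?opprK // lerN2.
Qed.

Section EuclideanPlane.
Variables (R : realType) (N : R -> R -> R).
Hypothesis N_homog : forall l r s, N (l * r) (l * s) = `|l| * N r s.
Hypothesis N_triangle : forall r s r' s', N (r + r') (s + s') <= N r s + N r' s'.
Hypothesis N01 : N 0 1 = 1.
Hypothesis N_day : forall r s r' s',
  N (r + r') (s + s') * N (r - r') (s - s') <= N r s ^+ 2 + N r' s' ^+ 2.

Section Normalized.
Hypothesis N_ge : forall a, `|a| <= N 1 (- a).

Let g a := N 1 (- a).

Let g_ge0 a : 0 <= g a. Proof. exact: le_trans (N_ge a). Qed.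

Let N0s s : N 0 s = `|s|.
Proof.
have -> : N 0 s = N (s * 0) (s * 1) by rewrite mulr0 mulr1.
by rewrite N_homog N01 mulr1.
Qed.

Let g_lip1 a b : g a <= g b + `|a - b|.
Proof.
have -> : g a = N (1 + 0) (- b + - (a - b)) by rewrite /g; congr N; ring.
by rewrite -(normrN (a - b)) -N0s.
Qed.

Let g_lip a b : `|g a - g b| <= `|a - b|.
Proof.
have h1 := g_lip1 a b; have h2 := g_lip1 b a; rewrite distrC in h2.
by rewrite ler_norml; lra.
Qed.

Let g_prod a : g a * g (- a) <= g 0 ^+ 2 + a ^+ 2.
Proof.
have := N_day 1 0 0 (- a); rewrite N0s normrN real_normK ?num_real //.
by rewrite addr0 subr0 add0r sub0r /g oppr0.
Qed.

(** By [g_prod] and [N_ge], (g a - |a|)|a| is at most g(0)^2, and by the Lipschitz bound g a + |a|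
    is at most 2|a| + g 0. The product contributes 2 g(0)^2 + g(0)^2. *)
Let g_bound a : g a ^+ 2 - a ^+ 2 <= 3 * g 0 ^+ 2.
Proof.
have h1 := g_prod a; have := N_ge (- a); have := N_ge a; have := g_ge0 0.
have := g_lip1 a 0; rewrite subr0 normrN -!/(g _).
have : `|a| ^+ 2 = a ^+ 2 by rewrite real_normK ?num_real.
have : 0 <= `|a| by [].
move: h1; set b := `|a|; set u := g a; set v := g (- a); set w := g 0.
move=> h1 b0 <- h2 w0 h3 h4.
have h5 : (u - b) * b <= w ^+ 2.
  have : `|a| ^+ 2 = a ^+ 2 by rewrite real_normK ?num_real.
  by move: h1; rewrite -/b; nra.
have h6 : (u - b) * (u + b) <= (u - b) * (2 * b + w) by apply: ler_wpM2l; lra.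
have h7 : (u - b) * w <= w * w by apply: ler_wpM2r; lra.
nra.
Qed.

(* The least [M] for which the squared norm [g a ^+ 2] is at most [a ^+ 2 + M]; a zero of
   the defect [d] below is a point of contact of the two. *)
Let M := sup [set x | exists a, x = g a ^+ 2 - a ^+ 2]%classic.

Let M_has_sup : has_sup [set x | exists a, x = g a ^+ 2 - a ^+ 2]%classic.
Proof.
split; first by exists (g 0 ^+ 2 - 0 ^+ 2); exists 0.
by exists (3 * g 0 ^+ 2) => x [a ->]; exact: g_bound.
Qed.

Let g_le a : g a ^+ 2 <= a ^+ 2 + M.
Proof. rewrite addrC -lerBlDr; apply: (sup_upper_bound M_has_sup); by exists a. Qed.

Let g_adh eps : 0 < eps -> exists a, a ^+ 2 + M - eps < g a ^+ 2.
Proof.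
move=> e0; have [x [a ->] h] := sup_adherent e0 M_has_sup; exists a.
by move: h; rewrite -/M; lra.
Qed.

Let M_ge0 : 0 <= M.
Proof. by have := g_le 0; have := sqr_ge0 (g 0); rewrite expr0n /=; lra. Qed.

Let N_le r s : N r (- s) ^+ 2 <= s ^+ 2 + r ^+ 2 * M.
Proof.
have [->|r0] := eqVneq r 0; first by rewrite N0s normrN real_normK ?num_real // expr0n /= mul0r addr0.
have -> : N r (- s) = N (r * 1) (r * (- (s / r))) by congr N; field.
rewrite N_homog exprMn real_normK ?num_real //.
have : r ^+ 2 * g (s / r) ^+ 2 <= r ^+ 2 * ((s / r) ^+ 2 + M).
  by apply: ler_wpM2l; rewrite ?sqr_ge0.
by rewrite mulrDr -[r ^+ 2 * (s / r) ^+ 2]exprMn [r * (s / r)]mulrC divfK.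
Qed.

(** Applied to a sum and a difference, [N_day] turns into a lower bound for squared norms, to be
    played against the upper bound [g_le]. *)
Let parallelogram r s r' s' :
  4 * (N r (- s) * N r' (- s')) <= N (r + r') (- (s + s')) ^+ 2 + N (r - r') (- (s - s')) ^+ 2.
Proof.
have := N_day (r + r') (- (s + s')) (r - r') (- (s - s')).
have -> : N (r + r' + (r - r')) (- (s + s') + - (s - s')) = N (2 * r) (2 * - s).
  by congr N; ring.
have -> : N (r + r' - (r - r')) (- (s + s') - - (s - s')) = N (2 * r') (2 * - s').
  by congr N; ring.
by rewrite !N_homog ger0_norm // mulrACA -natrM.
Qed.

(** The defect compares norms and not their squares, so that it is globally Lipschitz as [last_zero]
    and [first_zero] require. *)
Let d a := Num.sqrt (a ^+ 2 + M) - g a.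

Let q_ge0 a : 0 <= a ^+ 2 + M. Proof. by rewrite addr_ge0 ?sqr_ge0. Qed.

Let q_lip1 a b : Num.sqrt (a ^+ 2 + M) <= Num.sqrt (b ^+ 2 + M) + `|a - b|.
Proof.
rewrite -(@ler_pXn2r _ 2) ?nnegrE ?addr_ge0 ?sqrtr_ge0 //.
rewrite sqrrD !sqr_sqrtr // real_normK ?num_real //.
have : `|b| <= Num.sqrt (b ^+ 2 + M) by rewrite -sqrtr_sqr ler_wsqrtr // lerDl.
have : b * (a - b) <= `|b| * `|a - b| by rewrite -normrM ler_norm.
set s := Num.sqrt _ => h1 h2.
have : `|b| * `|a - b| <= s * `|a - b| by apply: ler_wpM2r.
lra.
Qed.

Let d_lip a b : `|d a - d b| <= 2 * `|a - b|.
Proof.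
have := g_lip1 a b; have := g_lip1 b a; have := q_lip1 a b; have := q_lip1 b a.
by rewrite (distrC b a) ler_norml /d; lra.
Qed.

Let contactE a : (d a = 0) <-> (g a ^+ 2 = a ^+ 2 + M).
Proof.
split=> [/eqP|h]; first by rewrite subr_eq0 => /eqP <-; rewrite sqr_sqrtr.
by rewrite /d -h sqrtr_sqr ger0_norm // subrr.
Qed.

(* Bisecting the angle between a contact point and the point at infinity. *)
Let defect_infty a :
  ((a - g a) ^+ 2 + M - g (a - g a) ^+ 2) + ((a + g a) ^+ 2 + M - g (a + g a) ^+ 2)
    <= 2 * (a ^+ 2 + M - g a ^+ 2).
Proof.
(* The vector at infinity is scaled by [g a] to have the same norm as (1, -a); sum and difference
   then point along the bisectors. *)
have := parallelogram 1 a 0 (g a).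
rewrite N0s normrN ger0_norm // addr0 subr0 -/(g a) -/(g (a + g a)) -/(g (a - g a)).
nra.
Qed.

Let contact_infty a : d a = 0 -> d (a - g a) = 0 /\ d (a + g a) = 0.
Proof.
move=> /contactE h; have := defect_infty a; have := g_le (a - g a); have := g_le (a + g a).
by move=> h1 h2 h3; split; apply/contactE; lra.
Qed.

(** Scaling (1, -a) by [g b] and (1, -b) by [g a] gives vectors of equal norm. Their sum has slope
    [c], and the lower bound [parallelogram] meets the upper bounds [g_le] and [N_le] exactly.
    Positivity of [M] makes both weights positive. *)
Let contact_bisect a b : 0 < M -> a < b -> d a = 0 -> d b = 0 ->
  exists2 c, a < c < b & d c = 0.
Proof.
move=> M0 ab /contactE ha /contactE hb.
have g0 x : g x ^+ 2 = x ^+ 2 + M -> 0 < g x.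
  move=> h; rewrite lt_def g_ge0 andbT; apply/eqP => h0.
  by have := sqr_ge0 x; move: h; rewrite h0 expr0n /=; lra.
have ga := g0 _ ha; have gb := g0 _ hb.
pose u := g a; pose v := g b; have uv : 0 < u + v by rewrite addr_gt0.
exists ((a * v + b * u) / (u + v)).
  have h1 : 0 < (b - a) * u by rewrite mulr_gt0 // subr_gt0.
  have h2 : 0 < (b - a) * v by rewrite mulr_gt0 // subr_gt0.
  by rewrite ltr_pdivlMr // ltr_pdivrMr //; apply/andP; split; lra.
apply/contactE.
have := parallelogram v (a * v) u (b * u).
have -> : N v (- (a * v)) = v * u.
  have -> : N v (- (a * v)) = N (v * 1) (v * - a) by congr N; ring.
  by rewrite N_homog gtr0_norm.
have -> : N u (- (b * u)) = u * v.
  have -> : N u (- (b * u)) = N (u * 1) (u * - b) by congr N; ring.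
  by rewrite N_homog gtr0_norm.
have -> : N (v + u) (- (a * v + b * u)) = (u + v) * g ((a * v + b * u) / (u + v)).
  have -> : N (v + u) (- (a * v + b * u)) =
      N ((u + v) * 1) ((u + v) * - ((a * v + b * u) / (u + v))).
    by rewrite mulr1 mulrN [(u + v) * (_ / _)]mulrC divfK ?lt0r_neq0 // addrC.
  by rewrite N_homog gtr0_norm.
have := N_le (v - u) (a * v - b * u).
have := g_le ((a * v + b * u) / (u + v)).
set c := _ / _; have hc : c * (u + v) = a * v + b * u by rewrite divfK // lt0r_neq0.
set w := N _ _; set z := g c => h1 h2 h3.
apply/eqP; rewrite eq_le h1 /=.
have hu : u ^+ 2 = a ^+ 2 + M := ha.
have hv : v ^+ 2 = b ^+ 2 + M := hb.
have uv2 : 0 < (u + v) ^+ 2 by rewrite exprn_gt0.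
rewrite -(ler_pM2l uv2).
have -> : (u + v) ^+ 2 * (c ^+ 2 + M) = (c * (u + v)) ^+ 2 + (u + v) ^+ 2 * M by ring.
rewrite hc.
have e1 : (a * v + b * u) ^+ 2 + (a * v - b * u) ^+ 2 = 2 * (u ^+ 2 - M) * v ^+ 2 + 2 * (v ^+ 2 - M) * u ^+ 2.
  have -> : u ^+ 2 - M = a ^+ 2 by rewrite hu addrK.
  have -> : v ^+ 2 - M = b ^+ 2 by rewrite hv addrK.
  by ring.
move: h2 h3; rewrite exprMn; lra.
Qed.

(** Let e be the minimum of the squared defect on [-s, s], where s^2 = M. If e > 0, take [a] with
    squared defect below e/2. One of a - g a and a + g a lies in [-s, s], so [defect_infty] makes e
    less than itself. *)
Let contact_exists : exists a, d a = 0.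
Proof.
pose s := Num.sqrt M; have s0 : 0 <= s by exact: sqrtr_ge0.
have cont : {within `[- s, s]%classic, continuous (fun a => a ^+ 2 + M - g a ^+ 2)}%classic.
  apply: continuous_subspaceT => x.
  have gc : (g y @[y --> x] --> g x)%classic.
    apply/cvgrPdist_le => e e0; near=> y; apply: le_trans (g_lip _ _) _.
    by near: y; apply: cvgr_dist_le.
  apply: cvgB; last exact: (cvgM gc gc).
  apply: cvgD; last exact: cvg_cst.
  exact: (cvgM cvg_id cvg_id).
have ss : - s <= s by lra.
have [c _ hc] := EVT_min ss cont.
exists c; apply/contactE/eqP; rewrite eq_le g_le /= leNgt; apply/negP => hlt.
pose e := c ^+ 2 + M - g c ^+ 2; have e0 : 0 < e by rewrite subr_gt0.
have [a ha] : exists a, a ^+ 2 + M - e / 2 < g a ^+ 2 by apply: g_adh; lra.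
have key b : - s <= b <= s -> e <= b ^+ 2 + M - g b ^+ 2 by move=> h; exact: hc.
have s2 : s ^+ 2 = M by rewrite sqr_sqrtr.
have := defect_infty a.
have := g_le a; have := N_ge a; rewrite -/(g a) => h1 h2 h3.
have := g_le (a - g a); have := g_le (a + g a) => h4 h5.
have [a0|a0] := lerP 0 a.
  rewrite ger0_norm // in h1.
  have : e <= (a - g a) ^+ 2 + M - g (a - g a) ^+ 2.
    apply: key; nra.
  lra.
rewrite ltr0_norm // in h1.
have : e <= (a + g a) ^+ 2 + M - g (a + g a) ^+ 2 by apply: key; nra.
lra.
Unshelve. all: by end_near.
Qed.

(* A maximal interval free of contact points would contain the one bisecting its endpoints. *)
Let contact_everywhere a : 0 < M -> d a = 0.
Proof.
move=> M0; apply: contrapT => da.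
have above b : d b = 0 -> b < a -> False.
  move=> db ba; have [lo [dlo _ loa lomax]] := last_zero d_lip db (ltW ba).
  have lt_lo : lo < a.
    by rewrite lt_neqAle loa andbT; apply/eqP => loE; apply: da; rewrite -loE.
  have glo : 0 < g lo.
    rewrite lt_def g_ge0 andbT; apply/eqP => g0.
    by move/contactE: dlo; rewrite g0 expr0n /= => /eqP; rewrite eq_sym gt_eqF // ltr_wpDl ?sqr_ge0.
  have [_ dlo'] := contact_infty dlo.
  have : a <= lo + g lo.
    by rewrite leNgt; apply/negP => /ltW /(lomax _ dlo'); rewrite gerDl leNgt glo.
  move=> /(first_zero d_lip dlo')[hi [dhi _ ahi himin]].
  have [c /andP[c1 c2] dc] := contact_bisect M0 (lt_le_trans lt_lo ahi) dlo dhi.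
  have [ca|ac] := lerP c a.
    by have := lomax _ dc ca; rewrite leNgt c1.
  by have := himin _ dc (ltW ac); rewrite leNgt c2.
have [b db] := contact_exists.
have [|ab] := ltP b a; first exact: above db.
have [hi [dhi _ ahi himin]] := first_zero d_lip db ab.
(* The first contact [hi] from [a] on yields another at [hi - g hi]. This one lies below [a], since
   otherwise minimality of [hi] gives [g hi = 0], against [0 < M]. *)
have [dhi' _] := contact_infty dhi.
apply: (above _ dhi'); rewrite ltNge; apply/negP => h.
have hg : g hi <= 0 by have := himin _ dhi' h; lra.
have g0 : g hi = 0 by apply/eqP; rewrite eq_le hg g_ge0.
move/contactE: dhi; rewrite g0 expr0n /= => /eqP.
by rewrite eq_sym gt_eqF // ltr_wpDl ?sqr_ge0.
Qed.

Lemma normalized_euclidean :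
  exists2 K, 0 <= K & forall a, N 1 (- a) ^+ 2 = a ^+ 2 + K.
Proof.
exists M => // a; have [M0|M0] := ltrP 0 M.
  exact/contactE/contact_everywhere.
(* For [M = 0] the bounds [N_ge] and [g_le] coincide. *)
have {M0} M0 : M = 0 by apply/eqP; rewrite eq_le M0 M_ge0.
have h := N_ge a; have h2 := g_le a.
have h3 : `|a| ^+ 2 <= g a ^+ 2 by rewrite ler_pXn2r ?nnegrE.
rewrite real_normK ?num_real // in h3.
by apply/eqP; rewrite eq_le h2 M0 addr0.
Qed.

End Normalized.


End EuclideanPlane.

(** An elementary Hahn-Banach argument provides [t]: by [key] it separates the numbers a - N 1 (-a)
    from the b + N 1 (-b). The shear s - t r then brings [N] into the normalized position [N_ge]. *)
Lemma euclidean_plane (R : realType) (N : R -> R -> R) :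
  (forall l r s, N (l * r) (l * s) = `|l| * N r s) ->
  (forall r s r' s', N (r + r') (s + s') <= N r s + N r' s') ->
  N 0 1 = 1 ->
  (forall r s r' s',
    N (r + r') (s + s') * N (r - r') (s - s') <= N r s ^+ 2 + N r' s' ^+ 2) ->
  exists t, exists2 K, 0 <= K & forall a, N 1 (- a) ^+ 2 = (a - t) ^+ 2 + K.
Proof.
move=> Nh Nt N1 Nd.
have N0s s : N 0 s = `|s|.
  have -> : N 0 s = N (s * 0) (s * 1) by rewrite mulr0 mulr1.
  by rewrite Nh N1 mulr1.
pose E := [set x | exists a, x = a - N 1 (- a)]%classic.
have key a b : a - N 1 (- a) <= b + N 1 (- b).
  have h : N 0 (b - a) <= N 1 (- a) + N 1 (- b).
    have -> : N 0 (b - a) = N (1 + (-1) * 1) (- a + (-1) * (- b)) by congr N; ring.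
    by apply: le_trans (Nt _ _ _ _) _; rewrite Nh normrN1 mul1r.
  have : `|a - b| <= N 1 (- a) + N 1 (- b) by move: h; rewrite N0s distrC.
  by have := ler_norm (a - b); lra.
have Esup : has_sup E.
  by split; [exists (0 - N 1 (- 0)), 0 | exists (0 + N 1 (- 0)) => x [a ->]; exact: key].
pose t := sup E.
have lo a : a - N 1 (- a) <= t by apply: (sup_upper_bound Esup); exists a.
have hi a : t <= a + N 1 (- a).
  by apply: ge_sup; [exists (0 - N 1 (- 0)), 0 | move=> x [b ->]; exact: key].
exists t.
have [||||a|K K0 HK] := @normalized_euclidean R (fun r s => N r (s - t * r)).
- by move=> l r s; rewrite -Nh; congr N; ring.
- move=> r s r' s'; have -> : s + s' - t * (r + r') = (s - t * r) + (s' - t * r') by ring.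
  exact: Nt.
- by rewrite mulr0 subr0.
- move=> r s r' s'; have -> : s + s' - t * (r + r') = (s - t * r) + (s' - t * r') by ring.
  have -> : s - s' - t * (r - r') = (s - t * r) - (s' - t * r') by ring.
  exact: Nd.
- have -> : - a - t * 1 = - (a + t) by ring.
  by have := lo (a + t); have := hi (a + t); rewrite ler_norml; lra.
exists K => // a; rewrite -HK; congr (N _ _ ^+ 2); ring.
Qed.

(** * Absolute-valued algebras with a two-sided unit *)

Section Bilinear.
Variables (R : realType) (V : lmodType R) (m : V -> V -> V).
Hypothesis m_bil : bilinear_prod m.

Lemma bilDl x y z : m (x + y) z = m x z + m y z.
Proof. by have := m_bil.1 1 x y z; rewrite !scale1r. Qed.
Lemma bilDr x y z : m z (x + y) = m z x + m z y.
Proof. by have := m_bil.2 1 x y z; rewrite !scale1r. Qed.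
Lemma bil0l z : m 0 z = 0.
Proof. by have := bilDl 0 0 z; rewrite addr0 => /esym/eqP; rewrite addrC -subr_eq0 addrK => /eqP. Qed.
Lemma bil0r z : m z 0 = 0.
Proof. by have := bilDr 0 0 z; rewrite addr0 => /esym/eqP; rewrite addrC -subr_eq0 addrK => /eqP. Qed.
Lemma bilZl a x z : m (a *: x) z = a *: m x z.
Proof. by have := m_bil.1 a x 0 z; rewrite bil0l !addr0. Qed.
Lemma bilZr a x z : m z (a *: x) = a *: m z x.
Proof. by have := m_bil.2 a x 0 z; rewrite bil0r !addr0. Qed.
Lemma bilNl x z : m (- x) z = - m x z.
Proof. by rewrite -scaleN1r bilZl scaleN1r. Qed.
Lemma bilNr x z : m z (- x) = - m z x.
Proof. by rewrite -scaleN1r bilZr scaleN1r. Qed.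

Definition bilE := (bilDl, bilDr, bilZl, bilZr, bilNl, bilNr, bil0l, bil0r).
End Bilinear.

Section Norm.
Variables (R : realType) (V : lmodType R) (nrm : V -> R).
Hypothesis nrmP : is_norm nrm.

Lemma nrm_eq0 x : nrm x = 0 -> x = 0. Proof. exact: nrmP.1. Qed.
Lemma nrmZ a x : nrm (a *: x) = `|a| * nrm x. Proof. exact: nrmP.2.1. Qed.
Lemma nrmD x y : nrm (x + y) <= nrm x + nrm y. Proof. exact: nrmP.2.2. Qed.
Lemma nrm0 : nrm 0 = 0. Proof. by rewrite -(scale0r 0) nrmZ normr0 mul0r. Qed.
Lemma nrmN x : nrm (- x) = nrm x.
Proof. by rewrite -scaleN1r nrmZ normrN1 mul1r. Qed.
Lemma nrm_ge0 x : 0 <= nrm x.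
Proof. by have := nrmD x (- x); rewrite subrr nrm0 nrmN; lra. Qed.
End Norm.

Section UnitalAbsoluteValued.
Variables (R : realType) (V : lmodType R) (m : V -> V -> V) (nrm : V -> R) (e : V).
Hypotheses (m_bil : bilinear_prod m) (nrmP : is_norm nrm).
Hypothesis nrmM : forall x y, nrm (m x y) = nrm x * nrm y.
Hypotheses (m1l : forall x, m e x = x) (m1r : forall x, m x e = x) (e0 : e != 0).

Let nrm_e : nrm e = 1.
Proof.
have := nrmM e e; rewrite m1l -[X in X = _]mulr1 => /mulfI -> //.
by apply: contra_neq e0; exact: nrm_eq0.
Qed.

Lemma unital_euclidean x :
  exists t, exists2 K, 0 <= K & forall a, nrm (x - a *: e) ^+ 2 = (a - t) ^+ 2 + K.
Proof.
have [|||r s r' s'|t [K K0 HK]] := @euclidean_plane R (fun r s => nrm (r *: x + s *: e)).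
- by move=> l r s; rewrite -nrmZ // scalerDr !scalerA.
- move=> r s r' s'; apply: le_trans (nrmD nrmP _ _); rewrite le_eqVlt; apply/orP; left.
  by apply/eqP; congr nrm; lmod.
- by rewrite scale0r add0r scale1r nrm_e.
- rewrite -nrmM.
  pose p := r *: x + s *: e; pose q := r' *: x + s' *: e.
  have -> : m ((r + r') *: x + (s + s') *: e) ((r - r') *: x + (s - s') *: e) =
            m p p - m q q.
    rewrite /p /q !(bilE m_bil) !m1l !m1r; lmod.
  by apply: le_trans (nrmD nrmP _ _) _; rewrite nrmN // !nrmM !expr2.
by exists t, K => // a; rewrite -HK scale1r scaleNr.
Qed.

(* [tau x *: e] is the orthogonal projection of [x] on the line through [e]. *)
Lemma trace_function : exists tau : V -> R,
  [/\ forall a x y, tau (a *: x + y) = a * tau x + tau y, tau e = 1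
    & forall x, m x x = (2 * tau x) *: x - (nrm x ^+ 2) *: e].
Proof.
have [tau tauP] := choice unital_euclidean.
have tau_uniq x t K : (forall a, nrm (x - a *: e) ^+ 2 = (a - t) ^+ 2 + K) -> tau x = t.
  have [L _ HL] := tauP x => HK.
  have := HK 0; have := HK 1; rewrite !HL; lra.
have tauZ b x : tau (b *: x) = b * tau x.
  have [->|b0] := eqVneq b 0.
    rewrite scale0r mul0r; apply: (@tau_uniq _ _ 0) => a.
    by rewrite sub0r nrmN // nrmZ // nrm_e mulr1 real_normK ?num_real // subr0 addr0.
  have [L _ HL] := tauP x; apply: (@tau_uniq _ _ (b ^+ 2 * L)) => a.
  have -> : b *: x - a *: e = b *: (x - (a / b) *: e).
    by rewrite scalerBr scalerA mulrCA divff // mulr1.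
  by rewrite nrmZ // exprMn real_normK ?num_real // HL; field.
have tauD x y : tau (x + y) = tau x + tau y.
  (* The triangle inequality along the line through [e] gives one inequality
     for each of the two directions to infinity. *)
  have [K K0 HK] := tauP x; have [L L0 HL] := tauP y; have [J J0 HJ] := tauP (x + y).
  (* The square root of u^2 + Z exceeds |u| by at most Z / (2|u|), which tends to 0 at infinity. *)
  have up z t Z : 0 <= Z -> (forall a, nrm (z - a *: e) ^+ 2 = (a - t) ^+ 2 + Z) ->
      forall u, u != 0 -> nrm (z - (t + u) *: e) <= `|u| + Z / (2 * `|u|).
    move=> Z0 HZ u u0; have u1 : 0 < `|u| by rewrite normr_gt0.
    rewrite -(@ler_pXn2r _ 2) ?nnegrE ?(nrm_ge0 nrmP) ?addr_ge0 ?divr_ge0 ?mulr_ge0 ?(ltW u1) //.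
    rewrite HZ; have -> : t + u - t = u by ring.
    rewrite -(real_normK (num_real u)).
    have -> : (`|u| + Z / (2 * `|u|)) ^+ 2 = `|u| ^+ 2 + Z + (Z / (2 * `|u|)) ^+ 2.
      by field; rewrite gt_eqF.
    by rewrite lerDl sqr_ge0.
  pose D := tau x + tau y - tau (x + y).
  have tail_bound : forall u, u != 0 -> `|2 * u + D| <= 2 * `|u| + (K + L) / (2 * `|u|).
    move=> u u0; have h1 := up _ _ _ K0 HK _ u0; have h2 := up _ _ _ L0 HL _ u0.
    have h3 := nrmD nrmP (x - (tau x + u) *: e) (y - (tau y + u) *: e).
    have h4 : `|2 * u + D| <= nrm (x - (tau x + u) *: e + (y - (tau y + u) *: e)).
      have -> : x - (tau x + u) *: e + (y - (tau y + u) *: e) =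
                x + y - (tau x + tau y + 2 * u) *: e by lmod.
      rewrite -(@ler_pXn2r _ 2) ?nnegrE ?(nrm_ge0 nrmP) // HJ real_normK ?num_real //.
      have -> : tau x + tau y + 2 * u - tau (x + y) = 2 * u + D by rewrite /D; ring.
      by rewrite lerDl.
    have -> : (K + L) / (2 * `|u|) = K / (2 * `|u|) + L / (2 * `|u|) by rewrite mulrDl.
    by lra.
  have D0 : `|D| <= 0.
    rewrite leNgt; apply/negP => D0.
    have KL : 0 <= K + L by rewrite addr_ge0.
    (* This [u] makes the error (K + L) / (2u) smaller than |D|; choosing [u] or [- u] by the sign
       of [D] contradicts [tail_bound]. *)
    pose u := (K + L + 1) / `|D|; have u0 : 0 < u by rewrite divr_gt0 // ltr_wpDl.
    have h w : `|w| = u -> `|2 * w + D| < 2 * u + `|D|.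
      move=> wu; apply: le_lt_trans (tail_bound w _) _; first by rewrite -normr_gt0 wu.
      rewrite wu ltrD2l ltr_pdivrMr; last exact: mulr_gt0.
      have -> : `|D| * (2 * u) = 2 * (K + L + 1) by rewrite mulrCA /u [`|D| * _]mulrC divfK ?gt_eqF.
      by lra.
    case/orP: (le_total 0 D) => Dsgn.
      have := h u (ger0_norm (ltW u0)); rewrite ger0_norm ?ltxx //.
        by rewrite ger0_norm // ltxx.
      by rewrite addr_ge0 // mulr_ge0 // ltW.
    have := h (- u); rewrite normrN (gtr0_norm u0) => /(_ erefl).
    rewrite ler0_norm; last by lra.
    by rewrite ler0_norm //; lra.
  by move: D0; rewrite normr_le0 subr_eq0 => /eqP <-.
exists tau; split.
- by move=> a x y; rewrite tauD tauZ.
- apply: (@tau_uniq _ _ 0) => a.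
  by rewrite -{1}(scale1r e) -scalerBl nrmZ // nrm_e mulr1 real_normK ?num_real //; ring.
move=> x; have [K K0 HK] := tauP x; pose y := x - tau x *: e.
have Hy a : nrm (y - a *: e) ^+ 2 = a ^+ 2 + K.
  have -> : y - a *: e = x - (tau x + a) *: e by rewrite /y; lmod.
  by rewrite HK; ring.
(* The distances from y^2 to 0 and to K e are K and 2K, the latter by factoring y^2 - K e. They
   force the projection of y^2 on the line through e to be -K e and its orthogonal part to
   vanish. *)
have yy : m y y = - (K *: e).
  have ny : nrm y ^+ 2 = K by have := Hy 0; rewrite scale0r subr0 expr0n /= add0r.
  have [KE|Kn] := eqVneq K 0.
    have -> : y = 0 by apply: (nrm_eq0 nrmP); apply/eqP; rewrite -sqrf_eq0 ny KE.
    by rewrite bil0l // KE scale0r oppr0.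
  pose s := Num.sqrt K; have s2 : s ^+ 2 = K by rewrite sqr_sqrtr.
  have [L L0 HL] := tauP (m y y).
  have h0 : nrm (m y y - 0 *: e) ^+ 2 = K ^+ 2 by rewrite scale0r subr0 nrmM -expr2 ny.
  have h1 : nrm (m y y - K *: e) ^+ 2 = 4 * K ^+ 2.
    have -> : m y y - K *: e = m (y - s *: e) (y - (- s) *: e).
      by rewrite !(bilE m_bil) !m1l !m1r -s2; lmod.
    by rewrite nrmM exprMn !Hy sqrrN s2; ring.
  have tE : tau (m y y) = - K.
    by move: h0 h1; rewrite !HL => h0 h1; apply: (mulfI Kn); lra.
  have LE : L = 0 by move: h0; rewrite HL tE; lra.
  have : nrm (m y y - (- K) *: e) ^+ 2 = 0 by rewrite HL tE LE; ring.
  move/eqP; rewrite sqrf_eq0 => /eqP/(nrm_eq0 nrmP)/eqP.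
  by rewrite subr_eq0 scaleNr => /eqP.
have nx : nrm x ^+ 2 = tau x ^+ 2 + K by have := HK 0; rewrite scale0r subr0 sub0r sqrrN.
move: yy; rewrite /y !(bilE m_bil) !m1l !m1r nx => yy.
have -> : m x x = m x x + - tau x *: x + (- tau x *: x + tau x *: (tau x *: e)) +
    (2 * tau x) *: x - tau x ^+ 2 *: e by lmod.
have -> : m x x + - tau x *: x + (- tau x *: x + tau x *: (tau x *: e)) = - (K *: e).
  by rewrite -yy; lmod.
by lmod.
Qed.

(** Applying [tau] to the quadratic equation gives |x|^2 = 2 tau(x)^2 - tau(x^2), and [B] is its
    polarization. *)
Lemma inner_product : exists B : V -> V -> R,
  [/\ forall a x y z, B (a *: x + y) z = a * B x z + B y z,
      forall x y, B x y = B y x & forall x, B x x = nrm x ^+ 2].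
Proof.
have [tau [tauL tau1 quad]] := trace_function.
have tau0 : tau 0 = 0 by have := tauL 1 0 0; rewrite scale1r addr0; lra.
have tauZ a x : tau (a *: x) = a * tau x by rewrite -[a *: x]addr0 tauL tau0 addr0.
exists (fun x y => 2 * tau x * tau y - tau (m x y + m y x) / 2); split.
- move=> a x y z.
  have -> : m (a *: x + y) z + m z (a *: x + y) = a *: (m x z + m z x) + (m y z + m z y).
    by rewrite !(bilE m_bil); lmod.
  by rewrite !tauL; ring.
- by move=> x y; rewrite [m y x + m x y]addrC; ring.
move=> x; have -> : m x x + m x x = (4 * tau x) *: x + (- 2 * nrm x ^+ 2) *: e.
  by rewrite quad; lmod.
by rewrite tauL tauZ tau1; field.
Qed.

End UnitalAbsoluteValued.

(** * Composition algebras *)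

Record composition_algebra (R : realType) (V : lmodType R)
    (m : V -> V -> V) (e : V) (B : V -> V -> R) : Prop := {
  comp_bil : bilinear_prod m;
  comp_1l : forall x, m e x = x;
  comp_1r : forall x, m x e = x;
  comp_1 : B e e = 1;
  comp_lin : forall a x y z, B (a *: x + y) z = a * B x z + B y z;
  comp_sym : forall x y, B x y = B y x;
  comp_pos : forall x, x <> 0 -> 0 < B x x;
  comp_norm : forall x y, B (m x y) (m x y) = B x x * B y y
}.

Section CompositionAlgebra.
Variables (R : realType) (V : lmodType R) (m : V -> V -> V) (e : V) (B : V -> V -> R).
Hypothesis A : composition_algebra m e B.

Lemma formDl x y z : B (x + y) z = B x z + B y z.
Proof. by rewrite -[x]scale1r (comp_lin A) mul1r scale1r. Qed.
Lemma form0l z : B 0 z = 0.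
Proof. by have := formDl 0 0 z; rewrite addr0; lra. Qed.
Lemma formZl a x z : B (a *: x) z = a * B x z.
Proof. by rewrite -[a *: x]addr0 (comp_lin A) form0l addr0. Qed.
Lemma formNl x z : B (- x) z = - B x z.
Proof. by rewrite -scaleN1r formZl mulN1r. Qed.
Lemma formDr x y z : B z (x + y) = B z x + B z y.
Proof. by rewrite !(comp_sym A z) formDl. Qed.
Lemma form0r z : B z 0 = 0.
Proof. by rewrite (comp_sym A) form0l. Qed.
Lemma formZr a x z : B z (a *: x) = a * B z x.
Proof. by rewrite !(comp_sym A z) formZl. Qed.
Lemma formNr x z : B z (- x) = - B z x.
Proof. by rewrite !(comp_sym A z) formNl. Qed.

Definition formE := (formDl, formDr, formZl, formZr, formNl, formNr, form0l, form0r).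
Let mE := bilE (comp_bil A).
Let m1l := comp_1l A.
Let m1r := comp_1r A.
Let Bsym := comp_sym A.

Lemma form_eq0 x : B x x = 0 -> x = 0.
Proof. by move=> h; apply: contrapT => /(comp_pos A); rewrite h ltxx. Qed.

Lemma form_ext v w : (forall z, B v z = B w z) -> v = w.
Proof.
move=> h; apply/eqP; rewrite -subr_eq0; apply/eqP/form_eq0.
by rewrite formDl formNl h subrr.
Qed.

Lemma mul_eq0 x y : m x y = 0 -> x = 0 \/ y = 0.
Proof.
move=> h; have := comp_norm A x y; rewrite h form0l => /esym/eqP.
by rewrite mulf_eq0 => /orP[] /eqP /form_eq0; [left | right].
Qed.

Lemma form_mull x y z : B (m x y) (m x z) = B x x * B y z.
Proof.
have := comp_norm A x (y + z).
by rewrite !mE !formE !(comp_norm A) (Bsym z y) (Bsym (m x z)); lra.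
Qed.

Lemma form_mulr x y z : B (m x z) (m y z) = B x y * B z z.
Proof.
have := comp_norm A (x + y) z.
by rewrite !mE !formE !(comp_norm A) (Bsym y x) (Bsym (m y z)); lra.
Qed.

(** Linearizing the norm identity in both factors gives this; specializing one variable to [e]
    yields the two adjunction formulas below. *)
Lemma form_exchange x y z w :
  B (m x y) (m z w) + B (m x w) (m z y) = 2 * B x z * B y w.
Proof.
have := form_mull (x + z) y w; rewrite !mE !formE !form_mull.
by rewrite (Bsym z x) (Bsym (m z y)); lra.
Qed.

Definition comp_conj x := (2 * B x e) *: e - x.

Lemma conjK x : comp_conj (comp_conj x) = x.
Proof. by rewrite /comp_conj !formE (comp_1 A); lmod. Qed.

Lemma conj_imag x : B x e = 0 -> comp_conj x = - x.
Proof. by rewrite /comp_conj => ->; rewrite mulr0 scale0r add0r. Qed.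

Lemma conj_form x y : B (comp_conj x) y = B x (comp_conj y).
Proof. by rewrite /comp_conj !formE (Bsym e y); ring. Qed.

Lemma form_adjl x y z : B (m x y) z = B y (m (comp_conj x) z).
Proof.
have := form_exchange x y e z; rewrite /comp_conj !mE !m1l !formE (Bsym (m x z)); lra.
Qed.

Lemma form_adjr x y z : B (m x y) z = B x (m z (comp_conj y)).
Proof.
have := form_exchange x y z e; rewrite /comp_conj !mE !m1r !formE; lra.
Qed.

Lemma conj_mul x y : comp_conj (m x y) = m (comp_conj y) (comp_conj x).
Proof.
apply: form_ext => z.
by rewrite conj_form form_adjl -form_adjr [RHS]form_adjl conjK Bsym.
Qed.

(** A linearized alternative law, obtained by moving conjugates across the form; it stands in for
    associativity in what follows. *)
Lemma conj_mulK x y z :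
  m (comp_conj x) (m y z) + m (comp_conj y) (m x z) = (2 * B x y) *: z.
Proof.
apply: form_ext => w; rewrite !formE.
rewrite [B (m (comp_conj x) _) w]form_adjl [B (m (comp_conj y) _) w]form_adjl !conjK.
by have := form_exchange x z y w; rewrite (Bsym (m x w)); lra.
Qed.

Lemma mul_conjK x y z :
  m (m z x) (comp_conj y) + m (m z y) (comp_conj x) = (2 * B x y) *: z.
Proof.
apply: form_ext => w; rewrite !formE.
rewrite [B (m _ (comp_conj x)) w]form_adjr [B (m _ (comp_conj y)) w]form_adjr !conjK.
by have := form_exchange z x w y; lra.
Qed.

(** * Multiplication by an imaginary unit vector *)

Section Orthogonal.
Variable l : V.
Hypotheses (l_imag : B l e = 0) (l1 : B l l = 1).

Lemma orth_mulr x z : B x l = 0 -> m (m z l) x = m (m z (comp_conj x)) l.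
Proof.
move=> xl; have xl' : B (comp_conj x) l = 0 by rewrite conj_form conj_imag // formNr xl oppr0.
have := mul_conjK (comp_conj x) l z; rewrite xl' mulr0 scale0r conjK (conj_imag l_imag) !mE addrC.
by move/eqP; rewrite subr_eq0 => /eqP.
Qed.

Lemma orth_mull x z : B x l = 0 -> m x (m l z) = m l (m (comp_conj x) z).
Proof.
move=> xl; have xl' : B (comp_conj x) l = 0 by rewrite conj_form conj_imag // formNr xl oppr0.
have := conj_mulK (comp_conj x) l z; rewrite xl' mulr0 scale0r conjK (conj_imag l_imag) !mE.
by move/eqP; rewrite subr_eq0 => /eqP.
Qed.

Lemma orth_comm x : B x l = 0 -> m x l = m l (comp_conj x).
Proof. by move=> xl; have := orth_mull e xl; rewrite !m1r. Qed.

Lemma mul_imagK x : m (m x l) l = - x.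
Proof.
have := mul_conjK l l x; rewrite l1 (conj_imag l_imag) !mE => h.
apply/eqP; rewrite -addr_eq0 addrC; apply/eqP.
have : m (m x l) l + x = (- 2^-1) *: (- m (m x l) l - m (m x l) l - (2 * 1) *: x).
  have two : (2 : R) != 0 by rewrite pnatr_eq0.
  by lmod_coefs; field.
by rewrite h subrr scaler0 addrC.
Qed.

End Orthogonal.

(** As [V] is not known to be finite-dimensional, orthogonal projection onto the image is carried
    along in [emb_proj]; doubling preserves it. *)
Record composition_embedding (K : lmodType R) (mK : K -> K -> K) (cK : K -> K)
    (oneK : K) (f : K -> V) : Prop := {
  emb_lin : forall a x y, f (a *: x + y) = a *: f x + f y;
  emb_1 : f oneK = e;
  emb_M : forall x y, f (mK x y) = m (f x) (f y);
  emb_conj : forall x, f (cK x) = comp_conj (f x);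
  emb_inj : injective f;
  emb_proj : forall v, exists x, forall y, B (v - f x) (f y) = 0
}.

Section Embedding.
Variables (K : lmodType R) (mK : K -> K -> K) (cK : K -> K) (oneK : K) (f : K -> V).
Hypothesis fP : composition_embedding mK cK oneK f.

Lemma embD x y : f (x + y) = f x + f y.
Proof. by rewrite -[x]scale1r (emb_lin fP) !scale1r. Qed.
Lemma emb0 : f 0 = 0.
Proof. by apply/eqP; have /eqP := embD 0 0; rewrite addr0 -subr_eq0 opprD addNKr oppr_eq0. Qed.
Lemma embZ a x : f (a *: x) = a *: f x.
Proof. by rewrite -[a *: x]addr0 (emb_lin fP) emb0 addr0. Qed.
Lemma embN x : f (- x) = - f x.
Proof. by rewrite -scaleN1r embZ scaleN1r. Qed.

Lemma emb_orth : (exists v, forall x, f x <> v) ->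
  exists l, (forall x, B (f x) l = 0) /\ B l l = 1.
Proof.
case=> v hv; have [x hx] := emb_proj fP v.
have w0 : v - f x <> 0 by move/eqP; rewrite subr_eq0 => /eqP /esym; exact: hv.
have Bw := comp_pos A w0; set w := v - f x in hx w0 Bw.
exists ((Num.sqrt (B w w))^-1 *: w); split => [y|].
  by rewrite formZr Bsym hx mulr0.
rewrite formZl formZr mulrA -invfM -expr2 sqr_sqrtr ?(ltW Bw) // mulVf //.
exact: lt0r_neq0.
Qed.

Section Double.
Variable l : V.
Hypotheses (l_orth : forall x, B (f x) l = 0) (l1 : B l l = 1).

Let l_imag : B l e = 0. Proof. by rewrite Bsym -(emb_1 fP). Qed.

Let orth2 x y : B (f x) (m (f y) l) = 0.
Proof. by rewrite Bsym form_adjl -(emb_conj fP) -(emb_M fP) Bsym. Qed.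

Let prod12 u v : m (f u) (m (f v) l) = m (m (f v) (f u)) l.
Proof.
rewrite (orth_comm l_imag (l_orth v)) orth_mull // -!(emb_conj fP) -!(emb_M fP).
rewrite (orth_comm l_imag (l_orth _)) !(emb_M fP) !(emb_conj fP).
by rewrite conj_mul.
Qed.

Let prod22 y v : m (m (f y) l) (m (f v) l) = - m (comp_conj (f v)) (f y).
Proof.
(* For imaginary [v0] the vector [m (f v0) l] is orthogonal to [l], so [orth_mulr] applies; the
   scalar part is treated apart. *)
pose b := B (f v) e; pose v0 := v - b *: oneK.
have vE : f v = f v0 + b *: e by rewrite /v0 embD embN embZ (emb_1 fP) subrK.
have v0e : B (f v0) e = 0.
  by rewrite /v0 embD embN embZ (emb_1 fP) !formE (comp_1 A) mulr1 subrr.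
have v0l : B (m (f v0) l) l = 0 by rewrite -[X in B _ X]m1l form_mulr v0e mul0r.
have v0le : B (m (f v0) l) e = 0 by rewrite -(emb_1 fP) Bsym orth2.
have h1 : m (m (f y) l) (m (f v0) l) = m (f v0) (f y).
  by rewrite orth_mulr // conj_imag // !mE prod12 mul_imagK // opprK.
have h2 : m (m (f y) l) (m (b *: e) l) = - b *: f y.
  by rewrite !mE m1l mul_imagK // scalerN scaleNr.
rewrite vE mE [in LHS]bilDr ?h1 ?h2; last exact: comp_bil A.
rewrite /comp_conj !formE v0e (comp_1 A) !mE !m1l; lmod.
Qed.

(** The rules [prod12], [orth_mulr] and [prod22] for the mixed products with [l] are exactly the
    terms of [cd_mul]. Injectivity follows from orthogonality of the image of [f] and its translate
    by [l]. *)
Lemma emb_double : @composition_embedding (K * K)%type (cd_mul mK cK) (cd_conj cK)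
  (oneK, 0) (fun p => f p.1 + m (f p.2) l).
Proof.
split=> /=.
- by move=> a x y; rewrite !(emb_lin fP) !mE; lmod.
- by rewrite emb0 !mE (emb_1 fP) addr0.
- move=> x y; rewrite !embD embN !(emb_M fP) !mE prod12 prod22 !(emb_conj fP).
  rewrite (orth_mulr l_imag _ (l_orth y.1)); lmod.
- move=> x; rewrite embN (emb_conj fP) !mE.
  have h : B (m (f x.2) l) e = 0 by rewrite -(emb_1 fP) Bsym orth2.
  by rewrite /comp_conj !formE h; lmod.
- move=> x y h.
  have hd : f (x.1 - y.1) + m (f (x.2 - y.2)) l = 0.
    rewrite !embD !embN !mE.
    have -> : f x.1 - f y.1 + (m (f x.2) l - m (f y.2) l) =
       (f x.1 + m (f x.2) l) - (f y.1 + m (f y.2) l) by lmod.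
    by rewrite h subrr.
  have h1 : f (x.1 - y.1) = 0.
    by apply: form_eq0; have := orth2 (x.1 - y.1) (x.2 - y.2);
       move/eqP: hd; rewrite addrC addr_eq0 => /eqP ->; rewrite formNr => /eqP;
       rewrite oppr_eq0 => /eqP.
  move: hd; rewrite h1 add0r => /mul_eq0 [] h2; last first.
    by move: l1; rewrite h2 form0l => /eqP; rewrite eq_sym oner_eq0.
  move: h1 h2; rewrite -emb0 => /(emb_inj fP)/eqP; rewrite subr_eq0 => /eqP h1.
  move=> /(emb_inj fP)/eqP; rewrite subr_eq0 => /eqP h2.
  by case: x y h1 h2 {h} => [x1 x2] [y1 y2] /= -> ->.
(* Right multiplication by [l] is an isometry with square -1, so the second component comes from
   projecting [- m v l]. *)
- move=> v; have [x hx] := emb_proj fP v; have [y hy] := emb_proj fP (- m v l).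
  exists (x, y) => -[u w] /=.
  have hw : B v (m (f w) l) = B (f y) (f w).
    have := hy w; rewrite !formE Bsym => /eqP; rewrite subr_eq0 => /eqP <-.
    by rewrite Bsym form_adjr (conj_imag l_imag) !mE formNr.
  have := hx u; rewrite !formE hw orth2 (Bsym (m (f y) l) (f u)) orth2.
  by rewrite form_mulr l1; lra.
Qed.

End Double.
End Embedding.

(** * Hurwitz's theorem by iterated doubling *)

Definition onto (K : Type) (f : K -> V) := forall v, exists x, f x = v.

Lemma not_onto (K : Type) (f : K -> V) : ~ onto f -> exists v, forall x, f x <> v.
Proof. by move/existsNP => [v /forallNP h]; exists v. Qed.

Lemma emb_real : @composition_embedding (Rr R) (@Rmul R) id 1 (fun a : R => a *: e).
Proof.
have e0 : e != 0.
  by apply/eqP => e0; have := comp_1 A; rewrite e0 form0l => /eqP; rewrite eq_sym oner_eq0.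
split=> /=.
- by move=> a x y; rewrite scalerDl scalerA.
- exact: scale1r.
- by move=> x y; rewrite !mE m1l scalerA.
- by move=> x; rewrite /comp_conj formZl (comp_1 A); lmod.
- by move=> x y /eqP; rewrite -subr_eq0 -scalerBl scaler_eq0 (negPf e0) orbF subr_eq0 => /eqP.
- move=> v; exists (B v e) => y; rewrite !formE (comp_1 A); ring.
Qed.

(* The double of the octonions has zero divisors. *)
Lemma octonion_onto f : @composition_embedding (Oo R) (@Omul R) (@Oconj R) (((1, 0), 0), 0) f ->
  onto f.
Proof.
move=> fP; apply: contrapT => /not_onto /(emb_orth fP) [l [l_orth l1]].
have gP := emb_double fP l_orth l1.
have [p [q [pq p0 q0]]] := octonion_double_zero_divisor R.
have h := emb_M gP p q; rewrite pq in h.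
have g0 := emb0 gP; have g_inj := emb_inj gP.
by move: h; rewrite g0 => /esym /mul_eq0 []; rewrite -g0 => /g_inj.
Qed.

(** The clause [g (x, 0) = f x] keeps track of a chosen imaginary unit through the doubling, as
    [mixed_line] requires. *)
Lemma quaternion_onto_or_octonion f :
  @composition_embedding (Hh R) (@Hmul R) (@Hconj R) ((1, 0), 0) f ->
  onto f \/ exists2 g, @composition_embedding (Oo R) (@Omul R) (@Oconj R) (((1, 0), 0), 0) g
                     & onto g /\ forall x, g (x, 0) = f x.
Proof.
move=> fP; have [|/not_onto /(emb_orth fP) [l [l_orth l1]]] := pselect (onto f); first by left.
have gP := emb_double fP l_orth l1; right; exists (fun p => f p.1 + m (f p.2) l) => //.
by split => [|x /=]; [exact: octonion_onto | rewrite (emb0 fP) !mE addr0].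
Qed.

Lemma complex_onto_or_quaternion f :
  @composition_embedding (Cc R) (@Cmul R) (@Cconj R) (1, 0) f ->
  onto f \/ exists2 g, @composition_embedding (Hh R) (@Hmul R) (@Hconj R) ((1, 0), 0) g
                     & forall x, g (x, 0) = f x.
Proof.
move=> fP; have [|/not_onto /(emb_orth fP) [l [l_orth l1]]] := pselect (onto f); first by left.
have gP := emb_double fP l_orth l1; right; exists (fun p => f p.1 + m (f p.2) l) => //.
by move=> x /=; rewrite (emb0 fP) !mE addr0.
Qed.

Lemma hurwitz :
  [\/ exists2 f, @composition_embedding (Rr R) (@Rmul R) id 1 f & onto f,
      exists2 f, @composition_embedding (Cc R) (@Cmul R) (@Cconj R) (1, 0) f & onto f,
      exists2 f, @composition_embedding (Hh R) (@Hmul R) (@Hconj R) ((1, 0), 0) f & onto f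
    | exists2 f, @composition_embedding (Oo R) (@Omul R) (@Oconj R) (((1, 0), 0), 0) f & onto f].
Proof.
have fP := emb_real.
have [rS|/not_onto /(emb_orth fP) [l [l_orth l1]]] := pselect (onto (fun a : R => a *: e)).
  by apply: Or41; exists (fun a : R => a *: e).
have cP := emb_double fP l_orth l1.
have [cS|[g gP _]] := complex_onto_or_quaternion cP.
  by apply: Or42; eexists; [exact: cP|].
have [gS|[h hP [hS _]]] := quaternion_onto_or_octonion gP.
  by apply: Or43; exists g.
by apply: Or44; exists h.
Qed.

End CompositionAlgebra.

(** * Linear algebra and dimension *)

Section LinearAlgebra.
Variables (R : realType) (V : lmodType R).

(** Replacing t by 2t and subtracting 2^n times the original identity removes the top coefficient
    and multiplies the k-th one by the nonzero number 2^k - 2^n. *)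
Lemma vector_poly_eq0 n (v : nat -> V) :
  (forall t : R, \sum_(k < n) t ^+ k *: v k = 0) -> forall k, (k < n)%N -> v k = 0.
Proof.
elim: n v => [//|n IHn] v h.
have h1 k : (k < n)%N -> v k = 0.
  move=> kn; have : (2 ^+ k - 2 ^+ n) *: v k = 0.
    apply: (IHn (fun k => (2 ^+ k - 2 ^+ n) *: v k)) => //.
    move=> t; have := h (2 * t); rewrite big_ord_recr /= => h2.
    have h3 := h t; rewrite big_ord_recr /= in h3.
    have -> : \sum_(k < n) t ^+ k *: ((2 ^+ k - 2 ^+ n) *: v k) =
      \sum_(k < n) (2 * t) ^+ k *: v k - 2 ^+ n *: \sum_(k < n) t ^+ k *: v k.
      rewrite scaler_sumr -sumrB; apply: eq_bigr => i _.
      by rewrite exprMn; lmod.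
    move/eqP: h2; rewrite addr_eq0 => /eqP ->; move/eqP: h3; rewrite addr_eq0 => /eqP ->.
    by rewrite exprMn; lmod.
  move=> /eqP; rewrite scaler_eq0 subr_eq0 => /orP[|/eqP //].
  by rewrite -!natrX eqr_nat eqn_exp2l // (ltn_eqF kn).
move=> k; rewrite ltnS leq_eqVlt => /orP[/eqP->|]; last exact: h1.
have := h 1; rewrite big_ord_recr /= big1 ?add0r ?expr1n ?scale1r // => i _.
by rewrite h1 // scaler0.
Qed.

(** Since [dim_le] wants the spanning vectors inside [S], they are exchanged one by one: a vector of
    [S] outside the span of the first ones eliminates the last, and if there is none the family is
    padded with 0. *)
Lemma dim_le_of_span n (f : 'I_n -> V) (S : V -> Prop) :
  S 0 -> (forall (a : R) x y, S x -> S y -> S (a *: x + y)) ->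
  (forall v, S v -> in_span f v) -> dim_le S n.
Proof.
elim: n f S => [|n IHn] f S S0 SL Sf.
  by exists f; split => // -[].
pose f' i := f (lift ord_max i); pose S' v := S v /\ in_span f' v.
have span0 : in_span f' 0.
  by exists (fun _ => 0); rewrite big1 // => i _; rewrite scale0r.
have spanL (a : R) x y : in_span f' x -> in_span f' y -> in_span f' (a *: x + y).
  move=> [c ->] [d ->]; exists (fun i => a * c i + d i).
  rewrite scaler_sumr -big_split /=; apply: eq_bigr => i _.
  by rewrite scalerDl scalerA.
have [||v []//|g [gS hg]] := IHn f' S'; first by split.
  by move=> a x y [Sx fx] [Sy fy]; split; [exact: SL | exact: spanL].
have decomp v : in_span f v -> exists a w, v = a *: f ord_max + w /\ in_span f' w.
  move=> [c ->]; exists (c ord_max), (\sum_(i < n) c (lift ord_max i) *: f' i); split.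
    rewrite (bigD1_ord ord_max) //=.
  by exists (fun i => c (lift ord_max i)).
have [[s [Ss ns]]|h] := pselect (exists s, S s /\ ~ in_span f' s); last first.
  exists (fun i => if unlift ord_max i is Some j then g j else 0); split.
    by move=> i; case: unliftP => [j _|_ //]; have [] := gS j.
  move=> v Sv; have [c ->] : in_span g v.
    by apply: hg; split=> //; apply: contrapT => nv; apply: h; exists v.
  exists (fun i => if unlift ord_max i is Some j then c j else 0).
  rewrite (bigD1_ord ord_max) //= unlift_none scale0r add0r.
  by apply: eq_bigr => i _; rewrite !liftK.
have [a [w [sE wf]]] := decomp s (Sf s Ss).
have a0 : a != 0 by apply/eqP => a0; apply: ns; rewrite sE a0 scale0r add0r.
exists (fun i => if unlift ord_max i is Some j then g j else s); split.
  by move=> i; case: unliftP => [j _|_ //]; have [] := gS j.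
move=> v Sv; have [b [u [vE uf]]] := decomp v (Sf v Sv).
have E : - (b / a) *: s + v = - (b / a) *: w + u.
  by rewrite vE sE; lmod_coefs; field.
have [c hc] : in_span g (- (b / a) *: s + v).
  by apply: hg; split; [exact: SL | rewrite E; exact: spanL].
exists (fun i => if unlift ord_max i is Some j then c j else b / a).
rewrite (bigD1_ord ord_max) //= unlift_none.
under eq_bigr do rewrite !liftK.
by rewrite -hc; lmod.
Qed.

Lemma deg_leP mul n : (forall x, exists (f : 'I_n -> V) (S : V -> Prop),
    [/\ subalgebra mul S, S x & forall v, S v -> in_span f v]) ->
  deg_le mul n.
Proof.
move=> h x; have [f [S [Salg Sx Sf]]] := h x.
apply: (@dim_le_of_span _ f).
- by move=> T [].
- by move=> a y z hy hz T Talg Tx; apply: Talg.2.1; [exact: hy | exact: hz].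
- by move=> v hv; apply: Sf; exact: hv.
Qed.

End LinearAlgebra.

Section FiniteDimension.
Variable R : realType.

Lemma finite_dimensional_real : finite_dimensional (Rr R).
Proof.
exists 1, (fun _ => (1 : Rr R)) => v; exists (fun _ => v).
by rewrite big_ord1 /GRing.scale /= mulr1.
Qed.

Lemma finite_dimensional_prod (K L : lmodType R) :
  finite_dimensional K -> finite_dimensional L -> finite_dimensional (K * L)%type.
Proof.
move=> [n [f hf]] [p [g hg]].
exists (n + p)%N, (fun i => match split i with inl j => (f j, 0) | inr j => (0, g j) end).
move=> [v w]; have [c ->] := hf v; have [d ->] := hg w.
exists (fun i => match split i with inl j => c j | inr j => d j end).
rewrite big_split_ord /=.
have El i : split (lshift p i) = inl i :> 'I_n + 'I_p by exact: (unsplitK (inl i)).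
have Er i : split (rshift n i) = inr i :> 'I_n + 'I_p by exact: (unsplitK (inr i)).
under [X in _ = X + _]eq_bigr do rewrite El.
under [X in _ = _ + X]eq_bigr do rewrite Er.
have E1 : \sum_(i < n) c i *: (f i, 0 : L) = (\sum_(i < n) c i *: f i, 0).
  elim/big_rec2: _ => // i x y _ ->.
  by congr (_, _); rewrite /= scaler0 addr0.
have E2 : \sum_(i < p) d i *: (0 : K, g i) = (0, \sum_(i < p) d i *: g i).
  elim/big_rec2: _ => // i x y _ ->.
  by congr (_, _); rewrite /= scaler0 addr0.
by rewrite E1 E2; congr (_, _); rewrite /= ?addr0 ?add0r.
Qed.

Lemma finite_dimensional_iso (V W : lmodType R) mulV mulW :
  @alg_iso R V W mulV mulW -> finite_dimensional W -> finite_dimensional V.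
Proof.
move=> [f [fL [[g fK gK] _]]] [n [w hw]].
exists n, (fun i => g (w i)) => v; have [c hc] := hw (f v).
exists c; apply: (can_inj fK); rewrite hc.
have f0 : f 0 = 0.
  have := fL 1 0 0; rewrite !scale1r addr0 => /esym/eqP.
  by rewrite addrC -subr_eq0 addrK => /eqP.
apply: (big_rec2 (fun x y => x = f y)) => // i x y _ ->.
by rewrite fL gK.
Qed.

End FiniteDimension.

(** * The right multiplication by a left unit *)

Section LeftUnit.
Variables (R : realType) (V : lmodType R) (mul : V -> V -> V) (nrm : V -> R) (e : V).
Hypothesis algP : absolute_valued_algebra mul nrm.
Hypothesis eP : left_unit mul e.
Hypothesis assocP : forall x, associator mul (mul x x) (mul x x) (mul x x) = 0.

Let mul_bil : bilinear_prod mul. Proof. exact: algP.2.1. Qed.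
Let nrmP : is_norm nrm. Proof. exact: algP.2.2.1. Qed.
Let nrmM x y : nrm (mul x y) = nrm x * nrm y. Proof. exact: algP.2.2.2. Qed.
Let mulE := bilE mul_bil.

Let e_neq0 : e != 0.
Proof.
have [x x0] := algP.1; apply: contra_neq x0 => e0.
by rewrite -(eP x) e0 mulE.
Qed.

Let nrm_e : nrm e = 1.
Proof.
have := nrmM e e; rewrite eP -[X in X = _]mulr1 => /mulfI -> //.
by apply: contra_neq e_neq0; exact: nrm_eq0.
Qed.

Let r x := mul x e.
Let nrm_r x : nrm (r x) = nrm x. Proof. by rewrite /r nrmM nrm_e mulr1. Qed.
Let rD x y : r (x + y) = r x + r y. Proof. by rewrite /r mulE. Qed.
Let rN x : r (- x) = - r x. Proof. by rewrite /r !mulE. Qed.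

Let T := associator mul.
Let TDl x y z w : T (x + y) z w = T x z w + T y z w.
Proof. by rewrite /T /associator !mulE; lmod. Qed.
Let TDm x y z w : T z (x + y) w = T z x w + T z y w.
Proof. by rewrite /T /associator !mulE; lmod. Qed.
Let TDr x y z w : T z w (x + y) = T z w x + T z w y.
Proof. by rewrite /T /associator !mulE; lmod. Qed.
Let TZl (t : R) x z w : T (t *: x) z w = t *: T x z w.
Proof. by rewrite /T /associator !mulE; lmod. Qed.
Let TZm (t : R) x z w : T z (t *: x) w = t *: T z x w.
Proof. by rewrite /T /associator !mulE; lmod. Qed.
Let TZr (t : R) x z w : T z w (t *: x) = t *: T z w x.
Proof. by rewrite /T /associator !mulE; lmod. Qed.
Let Te z w : T e z w = 0.
Proof. by rewrite /T /associator !eP subrr. Qed.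
Let TE := (TDl, TDm, TDr, TZl, TZm, TZr, Te).

(* The coefficients of [t] and [t ^+ 2] in the identity at [x = e + t *: y]. *)
Let first_orders y : let a := y + r y in let b := mul y y in
  T a e e = 0 /\ T b e e + T a a e + T a e a = 0.
Proof.
move=> a b.
(* The square of e + t y is e + t a + t^2 b; these are the coefficients of its associator, terms
   with [e] in first place vanishing by [Te]. *)
pose c := [:: 0; T a e e; T b e e + T a a e + T a e a;
  T a b e + T b a e + T a e b + T b e a + T a a a;
  T b b e + T b e b + T a a b + T a b a + T b a a;
  T a b b + T b a b + T b b a; T b b b].
have h (t : R) : \sum_(k < 7) t ^+ k *: c`_k = 0.
  apply: etrans (assocP (e + t *: y)); rewrite -/T.
  have -> : mul (e + t *: y) (e + t *: y) = e + t *: a + t ^+ 2 *: b.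
    by rewrite !mulE !eP /a /b /r; lmod.
  rewrite !big_ord_recr big_ord0 /= !TE; lmod.
have ck := vector_poly_eq0 h.
by split; [exact: (ck 1) | exact: (ck 2)].
Qed.

(** The first-order relation reads r(r a) = r a for a = y + r y; being an isometry, [r] is
    injective, so r a = a. *)
Lemma right_unit_involutive y : r (r y) = y.
Proof.
have [h _] := first_orders y.
have {}h : r (r (y + r y)) = r (y + r y).
  by move/eqP: h; rewrite /T /associator eP subr_eq0 => /eqP.
have : r (r (y + r y) - (y + r y)) = 0 by rewrite rD rN h subrr.
move/(congr1 nrm); rewrite nrm_r (nrm0 nrmP) => /(nrm_eq0 nrmP)/eqP.
by rewrite rD [y + _]addrC subr_eq0 => /eqP /addrI.
Qed.

(* [mul x y = (x e) o y] for the product [o] below, which has the two-sided unit [e]. *)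
Let m x y := mul (r x) y.

Lemma isotope_composition : exists B : V -> V -> R,
  composition_algebra m e B /\ forall x y, B (r x) (r y) = B x y.
Proof.
have m_bil : bilinear_prod m.
  by split=> a x y z; rewrite /m /r !mulE; lmod.
have m1l x : m e x = x by rewrite /m /r !eP.
have m1r x : m x e = x by exact: right_unit_involutive.
have m_nrm x y : nrm (m x y) = nrm x * nrm y by rewrite /m nrmM nrm_r.
have [B [Blin Bsym Bnrm]] := inner_product m_bil nrmP m_nrm m1l m1r e_neq0.
have A : composition_algebra m e B.
  split=> //.
  - by rewrite Bnrm nrm_e expr1n.
  - move=> x x0; rewrite Bnrm exprn_gt0 // lt_def (nrm_ge0 nrmP) andbT.
    by apply/eqP => /(nrm_eq0 nrmP).
  - by move=> x y; rewrite !Bnrm m_nrm exprMn.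
exists B; split=> // x y.
have : B (r (x + y)) (r (x + y)) = B (x + y) (x + y) by rewrite !Bnrm nrm_r.
rewrite rD !(formE A) !Bnrm !nrm_r (Bsym y x) (Bsym (r y)); lra.
Qed.

(** As [r] fixes [a], the square of [a] is a combination of [a] and [e] and is fixed too. Only T b e
    e = b - r b survives in the second-order relation. *)
Lemma right_unit_square y : r (mul y y) = mul y y.
Proof.
have [B [A _]] := isotope_composition.
have [_] := first_orders y; set a := y + r y; set b := mul y y.
have ra : r a = a by rewrite /a rD right_unit_involutive addrC.
clearbody a b.
have aa : mul a a = (2 * B a e) *: a - B a a *: e.
  have := conj_mulK A a a e; rewrite /comp_conj !(bilE (comp_bil A)) !(comp_1l A) !(comp_1r A).
  rewrite /m ra => h.
  have -> : mul a a = (2 * B a e) *: a - 2^-1 *: ((2 * B a e) *: a - mul a a + ((2 * B a e) *: a - mul a a)).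
    by lmod_coefs; field.
  by rewrite h; lmod_coefs; field.
have ae : mul a e = a by exact: ra.
have aae : mul (mul a a) e = mul a a by rewrite {1}aa !mulE eP ae -aa.
have bee : mul (mul b e) e = b by exact: right_unit_involutive.
rewrite /T /associator !eP aae ae bee subrr !addr0.
by move/eqP; rewrite subr_eq0 => /eqP.
Qed.

End LeftUnit.

(** * Classification of the isotopes *)

Lemma alg_iso_of_onto (R : realType) (V K : lmodType R) mulV mulK (g : K -> V) :
  (forall a x y, g (a *: x + y) = a *: g x + g y) -> injective g ->
  (forall v, exists x, g x = v) ->
  (forall x y, g (mulK x y) = mulV (g x) (g y)) -> alg_iso mulV mulK.
Proof.
move=> gL g_inj g_onto gM; have [f fK] := choice g_onto.
exists f; split; last split.
- by move=> a x y; apply: g_inj; rewrite gL !fK.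
- by exists g => // x; apply: g_inj; rewrite fK.
- by move=> x y; apply: g_inj; rewrite gM !fK.
Qed.

Section Isotope.
Variables (R : realType) (V : lmodType R) (m mul : V -> V -> V) (e : V) (B : V -> V -> R).
Variable r : V -> V.
Hypothesis A : composition_algebra m e B.
Hypothesis mulE : forall x y, mul x y = m (r x) y.
Hypothesis r_lin : forall a x y, r (a *: x + y) = a *: r x + r y.
Hypothesis re : r e = e.
Hypothesis rK : forall x, r (r x) = x.
Hypothesis r_form : forall x y, B (r x) (r y) = B x y.
Hypothesis r_square : forall y, r (m (r y) y) = m (r y) y.

Let mE := bilE (comp_bil A).
Let BE := formE A.
Let m1l := comp_1l A.
Let m1r := comp_1r A.
Let Bsym := comp_sym A.
Let cj := comp_conj e B.

Let r0 : r 0 = 0.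
Proof.
by have /eqP := r_lin 1 0 0; rewrite !scale1r addr0 -subr_eq0 opprD addNKr oppr_eq0 => /eqP.
Qed.
Let rD x y : r (x + y) = r x + r y.
Proof. by rewrite -[x]scale1r r_lin !scale1r. Qed.
Let rZ a x : r (a *: x) = a *: r x.
Proof. by rewrite -[a *: x]addr0 r_lin r0 addr0. Qed.
Let rN x : r (- x) = - r x. Proof. by rewrite -scaleN1r rZ scaleN1r. Qed.
Let rE := (rD, rZ, rN, re, r0).

Let fixed_imag y := r y = y /\ B y e = 0.
Let anti z := r z = - z.

Let anti_imag z : anti z -> B z e = 0.
Proof. by move=> h; have := r_form z e; rewrite h re BE; lra. Qed.

Let fixed_anti_orth y z : r y = y -> anti z -> B y z = 0.
Proof. by move=> hy hz; have := r_form y z; rewrite hy hz BE; lra. Qed.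

Let imag_square y : B y e = 0 -> m y y = - B y y *: e.
Proof.
move=> h; have := conj_mulK A y y e; rewrite (conj_imag h) !m1r !mE => h2.
have -> : m y y = - 2^-1 *: (- m y y - m y y) by lmod_coefs; field.
by rewrite h2; lmod_coefs; field.
Qed.

Let imag_anticomm y z : B y e = 0 -> B z e = 0 -> B y z = 0 -> m z y = - m y z.
Proof.
move=> hy hz hyz; have := conj_mulK A y z e.
rewrite hyz mulr0 scale0r (conj_imag hy) (conj_imag hz) !m1r !mE => /eqP.
by rewrite addr_eq0 opprK => /eqP <-.
Qed.

Let imag_mulK y z : B y e = 0 -> m y (m y z) = - B y y *: z.
Proof.
move=> h; have := conj_mulK A y y z; rewrite (conj_imag h) !mE => h2.
have -> : m y (m y z) = - 2^-1 *: (- m y (m y z) - m y (m y z)) by lmod_coefs; field.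
by rewrite h2; lmod_coefs; field.
Qed.

Let imag_mulKr y z : B y e = 0 -> m (m z y) y = - B y y *: z.
Proof.
move=> h; have := mul_conjK A y y z; rewrite (conj_imag h) !mE => h2.
have -> : m (m z y) y = - 2^-1 *: (- m (m z y) y - m (m z y) y) by lmod_coefs; field.
by rewrite h2; lmod_coefs; field.
Qed.

Let fixed_anti_mul y z : fixed_imag y -> anti z -> fixed_imag (m y z).
Proof.
move=> [hy ye] hz; have ze := anti_imag hz; have yz := fixed_anti_orth hy hz.
split; last by rewrite (form_adjl A) m1r (conj_imag ye) BE Bsym yz oppr0.
have := r_square (y + z); rewrite rD hy hz !mE (imag_square ye) (imag_square ze).
rewrite (imag_anticomm ye ze yz) !rE => h.
have two : (2 : R) != 0 by rewrite pnatr_eq0.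
apply: (scalerI two).
transitivity (- B y y *: e + r (m y z) + (- - r (m y z) - - B z z *: e) + (B y y - B z z) *: e).
  by lmod.
by rewrite h; lmod.
Qed.

Let decomposition x : exists p q, [/\ fixed_imag p, anti q & x = B x e *: e + p + q].
Proof.
exists (2^-1 *: (x + r x) - B x e *: e), (2^-1 *: (x - r x)).
have rxe : B (r x) e = B x e by rewrite -{1}re r_form.
split.
- split; first by rewrite !rE rK [r x + x]addrC.
  by rewrite !BE rxe (comp_1 A); field.
- by rewrite /anti !rE rK; lmod.
- by lmod_coefs; field.
Qed.

Let normalize z : z <> 0 -> B ((Num.sqrt (B z z))^-1 *: z) ((Num.sqrt (B z z))^-1 *: z) = 1.
Proof.
move=> z0; have Bz := comp_pos A z0.
by rewrite !BE mulrA -invfM -expr2 sqr_sqrtr ?(ltW Bz) // mulVf // lt0r_neq0.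
Qed.

(** The parameter treats the identity (s = 0) and the conjugation (s = 1) together; in both cases
    [e] and [x] span a subalgebra. *)
Let pure_deg : (exists s : R, forall x, r x = (1 - s) *: x + s *: cj x) -> deg_le mul 2.
Proof.
move=> [s hr]; apply: deg_leP => x.
exists (fun i : 'I_2 => [:: e; x]`_i), (fun v => exists a b, v = a *: e + b *: x).
have xx : m x x = (2 * B x e) *: x - B x x *: e.
  have := conj_mulK A x x e; rewrite /comp_conj !m1r !mE !m1l => h.
  have -> : m x x = (2 * B x e) *: x - 2^-1 *: ((2 * B x e) *: x - m x x + ((2 * B x e) *: x - m x x)).
    by lmod_coefs; field.
  by rewrite h; lmod_coefs; field.
split.
- split; first by exists 0, 0; rewrite !scale0r addr0.
  split.
    move=> a _ _ [b [c ->]] [d [f ->]]; exists (a * b + d), (a * c + f); lmod.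
  move=> _ _ [a [b ->]] [c [d ->]].
  pose u := a + 2 * b * s * B x e; pose w := b * (1 - 2 * s).
  have -> : mul (a *: e + b *: x) (c *: e + d *: x) = m (u *: e + w *: x) (c *: e + d *: x).
    rewrite mulE hr /cj /comp_conj !BE (comp_1 A) /u /w; congr (m _ _); lmod.
  exists (u * c - w * d * B x x), (u * d + w * c + 2 * w * d * B x e).
  rewrite !mE !m1l !m1r xx; lmod.
- by exists 0, 1; rewrite scale0r add0r scale1r.
move=> v [a [b ->]]; exists (fun i : 'I_2 => [:: a; b]`_i).
by rewrite !big_ord_recr big_ord0 /= add0r.
Qed.

Definition degree2_models :=
  alg_iso mul (@Rmul R) \/ alg_iso mul (@Cmul R) \/ alg_iso mul (@starCmul R) \/
  alg_iso mul (@Hmul R) \/ alg_iso mul (@starHmul R) \/ alg_iso mul (@Omul R) \/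
  alg_iso mul (@starOmul R).

Definition degree4_models :=
  [\/ alg_iso mul (@starHi1mul R), alg_iso mul (@starOi1mul R),
      alg_iso mul (@Otildemul R) | alg_iso mul (@Otildeimul R)].

Let pure_fixed : (forall x, r x = x) -> degree2_models /\ deg_le mul 2.
Proof.
move=> rid; split; last by apply: pure_deg; exists 0 => x; rewrite rid; lmod.
have iso K mK cK oneK f : @composition_embedding _ _ m e B K mK cK oneK f -> onto f ->
    alg_iso mul mK.
  move=> fP f_onto; apply: (alg_iso_of_onto (emb_lin fP) (emb_inj fP) f_onto) => x y.
  by rewrite mulE rid (emb_M fP).
rewrite /degree2_models; case: (hurwitz A) => -[f fP /(iso _ _ _ _ _ fP)]; tauto.
Qed.

Let pure_anti : (forall x, r x = cj x) -> degree2_models /\ deg_le mul 2.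
Proof.
move=> rc; split; last by apply: pure_deg; exists 1 => x; rewrite rc; lmod.
have iso K mK cK oneK f : @composition_embedding _ _ m e B K mK cK oneK f -> onto f ->
    alg_iso mul (fun x y => mK (cK x) y).
  move=> fP f_onto; apply: (alg_iso_of_onto (emb_lin fP) (emb_inj fP) f_onto) => x y.
  by rewrite mulE rc (emb_M fP) (emb_conj fP).
rewrite /degree2_models; case: (hurwitz A) => -[f fP /(iso _ _ _ _ _ fP)] h.
- by left.
- by do 2 right; left.
- by do 4 right; left.
- by do 6 right.
Qed.

(** * The case where both eigenspaces are nonzero *)

Section Mixed.
Variables i j : V.
Hypotheses (i_anti : anti i) (i1 : B i i = 1) (j_fixed : fixed_imag j) (j1 : B j j = 1).

Let ie : B i e = 0. Proof. exact: anti_imag. Qed.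
Let ji : B j i = 0. Proof. exact: fixed_anti_orth j_fixed.1 i_anti. Qed.

(** With [p] and [q] the eigencomponents of [x], the vectors e, p, q and pq span a subalgebra, by a
    quaternion-like multiplication table. *)
Let mixed_deg : deg_le mul 4.
Proof.
apply: deg_leP => x; have [p [q [pP qP xE]]] := decomposition x.
have [rp pe] := pP; have qe := anti_imag qP; have pq := fixed_anti_orth rp qP.
have [rw we] := fixed_anti_mul pP qP; set w := m p q in rw we.
pose P := B p p; pose Q := B q q.
have pp : m p p = - P *: e := imag_square pe.
have qq : m q q = - Q *: e := imag_square qe.
have qp : m q p = - w := imag_anticomm pe qe pq.
have pw : m p w = - P *: q := imag_mulK q pe.
have wq : m w q = - Q *: p := imag_mulKr p qe.
have qw : m q w = Q *: p.
  by rewrite -[w]opprK -qp mE imag_mulK // scaleNr opprK.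
have wp : m w p = P *: q.
  by rewrite -[w]opprK -qp mE imag_mulKr // scaleNr opprK.
have ww : m w w = - (P * Q) *: e by rewrite imag_square // (comp_norm A).
exists (fun k : 'I_4 => [:: e; p; q; w]`_k).
exists (fun v => exists a b c d, v = a *: e + b *: p + c *: q + d *: w).
split.
- split; first by exists 0, 0, 0, 0; lmod.
  split.
    move=> t _ _ [a [b [c [d ->]]]] [a' [b' [c' [d' ->]]]].
    exists (t * a + a'), (t * b + b'), (t * c + c'), (t * d + d'); lmod.
  move=> _ _ [a [b [c [d ->]]]] [a' [b' [c' [d' ->]]]].
  exists (a * a' - b * b' * P + c * c' * Q - d * d' * (P * Q)).
  exists (a * b' + b * a' - c * d' * Q - d * c' * Q).
  exists (a * c' - c * a' - b * d' * P + d * b' * P).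
  exists (a * d' + d * a' + b * c' + c * b').
  rewrite mulE !rE rp rw qP !mE !m1l !m1r pp qq qp pw wq qw wp ww -/w; lmod.
- by exists (B x e), 1, 1, 0; rewrite {1}xE; lmod.
move=> v [a [b [c [d ->]]]]; exists (fun k : 'I_4 => [:: a; b; c; d]`_k).
by rewrite !big_ord_recr big_ord0 /= add0r.
Qed.

(** The relation [rel] has the 2 by 2 minors of the coefficients as its own coefficients;
    orthogonality makes them all vanish, which in turn forces [v] to be 0. *)
Let three_orthogonal (u v w f g : V) (a b a' b' a'' b'' : R) :
  u = a *: f + b *: g -> v = a' *: f + b' *: g -> w = a'' *: f + b'' *: g ->
  u <> 0 -> v <> 0 -> w <> 0 -> B u v = 0 -> B u w = 0 -> B v w = 0 -> False.
Proof.
move=> uE vE wE u0 v0 w0 uv uw vw.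
have Bu := comp_pos A u0; have Bv := comp_pos A v0; have Bw := comp_pos A w0.
have rel : (a' * b'' - a'' * b') *: u + (a'' * b - a * b'') *: v + (a * b' - a' * b) *: w = 0.
  by rewrite uE vE wE; lmod.
have h1 : a' * b'' - a'' * b' = 0.
  apply: (mulIf (lt0r_neq0 Bu)); rewrite mul0r.
  by have := congr1 (B ^~ u) rel; rewrite !BE (Bsym v u) (Bsym w u) uv uw; lra.
have h2 : a'' * b - a * b'' = 0.
  apply: (mulIf (lt0r_neq0 Bv)); rewrite mul0r.
  by have := congr1 (B ^~ v) rel; rewrite !BE uv (Bsym w v) vw; lra.
have h3 : b *: v - b' *: u = 0.
  have : a * b' - a' * b = 0.
    apply: (mulIf (lt0r_neq0 Bw)); rewrite mul0r.
    by have := congr1 (B ^~ w) rel; rewrite !BE uw vw; lra.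
  move=> h; have -> : b *: v - b' *: u = - (a * b' - a' * b) *: f by rewrite uE vE; lmod.
  by rewrite h oppr0 scale0r.
have h4 : a' *: w - a'' *: v = 0.
  have -> : a' *: w - a'' *: v = (a' * b'' - a'' * b') *: g by rewrite wE vE; lmod.
  by rewrite h1 scale0r.
have h5 : b' *: w - b'' *: v = 0.
  have -> : b' *: w - b'' *: v = - (a' * b'' - a'' * b') *: f by rewrite wE vE; lmod.
  by rewrite h1 oppr0 scale0r.
have a'0 : a' = 0.
  apply: (mulIf (lt0r_neq0 Bw)); rewrite mul0r.
  by have := congr1 (B ^~ w) h4; rewrite !BE vw; lra.
have b'0 : b' = 0.
  apply: (mulIf (lt0r_neq0 Bw)); rewrite mul0r.
  by have := congr1 (B ^~ w) h5; rewrite !BE vw; lra.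
by apply: v0; rewrite vE a'0 b'0; lmod.
Qed.

(** The element x = j + i generates x, then 2 ji, then 2(i - j), three nonzero and mutually
    orthogonal vectors. *)
Let mixed_not_deg2 : ~ deg_le mul 2.
Proof.
have [rj je] := j_fixed; pose w := m j i; have [rw we] := fixed_anti_mul j_fixed i_anti.
pose x := j + i; move/(_ x) => [f [_ hf]].
have ij : m i j = - w := imag_anticomm je ie ji.
have xx : mul x x = 2 *: w.
  rewrite mulE /x rD rj i_anti !mE (imag_square je) (imag_square ie) i1 j1 ij -/w; lmod.
have xxx : mul (mul x x) x = 2 *: (i - j).
  rewrite xx mulE rZ rw /x !mE imag_mulKr // i1.
  have -> : m w j = i by rewrite -[w]opprK -ij mE imag_mulKr // j1 scaleNr scale1r opprK.
  by lmod.
have sub v : gen_subalg mul x v -> exists a b, v = a *: f ord0 + b *: f ord_max.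
  move=> /hf [c ->]; exists (c ord0), (c ord_max).
  by rewrite big_ord_recl big_ord1; congr (_ + c _ *: f _); apply: val_inj.
have gx : gen_subalg mul x x by move=> S.
have gxx : gen_subalg mul x (mul x x).
  by move=> S SP Sx; apply: SP.2.2.
have gxxx : gen_subalg mul x (mul (mul x x) x).
  by move=> S SP Sx; apply: SP.2.2 => //; apply: SP.2.2.
have ww : B w w = 1 by rewrite (comp_norm A) i1 j1 mulr1.
have wi : B w i = 0 by rewrite -[X in B _ X]m1l (form_mulr A) je mul0r.
have wj : B w j = 0 by rewrite -[X in B _ X]m1r (form_mull A) ie mulr0.
have nz v : B v v <> 0 -> v <> 0 by move=> h v0; apply: h; rewrite v0 BE.
have [a [b h1]] := sub _ gx; have [a' [b' h2]] := sub _ gxx; have [a'' [b'' h3]] := sub _ gxxx.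
apply: (three_orthogonal h1 h2 h3).
- by apply: nz; rewrite /x !BE (Bsym i j) ji i1 j1; lra.
- by apply: nz; rewrite xx !BE ww; lra.
- by apply: nz; rewrite xxx !BE (Bsym i j) ji i1 j1; lra.
- by rewrite xx /x !BE (Bsym j w) (Bsym i w) wi wj; ring.
- by rewrite xxx /x !BE (Bsym i j) ji i1 j1; ring.
- by rewrite xxx xx !BE wi wj; ring.
Qed.

Let complex_emb : @composition_embedding _ _ m e B (Cc R) (@Cmul R) (@Cconj R) (1, 0)
  (fun p => p.1 *: e + m (p.2 *: e) i).
Proof.
by apply: (emb_double A (emb_real A)) => // x; rewrite BE (Bsym e) ie mulr0.
Qed.

(* The map [w |-> - i w] carries [(w* i) v] to the product twisted by the reflection in [i]. *)
Let reflection_iso (K : lmodType R) mK cK oneK iK g :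
  @composition_embedding _ _ m e B K mK cK oneK g -> onto g -> g iK = i ->
  (forall a v, mK iK (mK (mK a iK) v) = mK (mK iK a) (mK iK v)) ->
  (forall z, anti z -> z = B z i *: i) ->
  alg_iso mul (fun x y => mK (mK (cK x) iK) y).
Proof.
move=> gP g_onto gi middle line.
have r_refl x : r x = x - (2 * B x i) *: i.
  have [p [q [[rp pe] hq xE]]] := decomposition x.
  have xi : B x i = B q i by rewrite xE !BE (Bsym e) ie (fixed_anti_orth rp i_anti); ring.
  by rewrite xi {1 2}xE !rE rp hq (line _ hq) !BE i1; lmod.
have iK2 v : m i (m i v) = - v by rewrite imag_mulK // i1 scaleN1r.
apply: (@alg_iso_of_onto _ _ _ _ _ (fun w => - m i (g w))).
- by move=> a x y; rewrite (emb_lin gP) !mE; lmod.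
- move=> x y /(congr1 (m i)); rewrite !mE !iK2 !opprK; exact: (emb_inj gP).
- move=> v; have [x hx] := g_onto (m i v); exists x.
  by rewrite hx iK2 opprK.
move=> x y.
(* Hence the product of -ix and -iy is minus the product of i conj(x) and iy, to which [middle]
   applies. *)
have r_img w : r (- m i w) = m i (cj w).
  rewrite r_refl; have -> : B (- m i w) i = - B w e.
    by rewrite BE -{2}[i]m1r (form_mull A) i1 mul1r.
  by rewrite /cj /comp_conj !mE m1r; lmod.
rewrite mulE r_img /cj -(emb_conj gP) !mE -gi -!(emb_M gP) middle.
by [].
Qed.

Let mixed_line : (forall z, anti z -> z = B z i *: i) ->
  alg_iso mul (@starHi1mul R) \/ alg_iso mul (@starOi1mul R).
Proof.
move=> line; have [C_onto|[g gP gE]] := complex_onto_or_quaternion A complex_emb.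
  (* The unit vector [j] is orthogonal to both [e] and [i], so the complex plane cannot be
     everything. *)
  have [[a b] /= h] := C_onto j.
  have := j1; rewrite -{1}h !mE m1l !BE (Bsym e) (Bsym i) j_fixed.2 ji; lra.
have gi : g (Hi R) = i.
  by rewrite (_ : Hi R = ((0, 1), 0)) // gE /= scale0r scale1r m1l add0r.
have [g_onto|[h hP [h_onto hE]]] := quaternion_onto_or_octonion A gP.
  left; apply: (reflection_iso gP g_onto gi _ line) => a v; exact: Hmul_i_middle.
right; apply: (@reflection_iso _ _ _ _ (Oi R) _ hP h_onto _ _ line).
  by rewrite -gi -hE.
exact: Omul_i_middle.
Qed.

(** The units [i] and [k] generate a quaternion algebra on which [r] is the conjugation. Doubling it
    by [j] exhausts [V], and [r] fixes the new half. *)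
Let mixed_plane k : anti k -> B k k = 1 -> B k i = 0 -> alg_iso mul (@Otildemul R).
Proof.
move=> hk k1 ki; have ke := anti_imag hk; have [rj je] := j_fixed.
have [g [gP g_span]] : exists g, @composition_embedding _ _ m e B (Hh R) (@Hmul R) (@Hconj R) ((1, 0), 0) g
    /\ forall x, exists a z, anti z /\ g x = a *: e + z.
  have gP := emb_double A complex_emb (l := k) _ k1.
  exists (fun p => (p.1.1 *: e + m (p.1.2 *: e) i) + m (p.2.1 *: e + m (p.2.2 *: e) i) k).
  split; first by apply: gP => x; rewrite !mE !BE m1l (Bsym e) (Bsym i) ke ki; ring.
  have hik : anti (m i k).
    (* The V+ component [p] of ik vanishes: B(ik, p) = B(k, pi), where pi lies in V+ and [k] in
       V-. *)
    have [p [q [pP hq E]]] := decomposition (m i k).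
    have ike : B (m i k) e = 0 by rewrite (form_adjl A) m1r (conj_imag ie) BE ki oppr0.
    have [rip _] := fixed_anti_mul pP i_anti.
    have p0 : p = 0.
      apply: (form_eq0 A).
      have h1 : B (m i k) p = 0.
        rewrite (form_adjl A) (conj_imag ie) mE.
        rewrite (imag_anticomm pP.2 ie (fixed_anti_orth pP.1 i_anti)) opprK Bsym.
        exact: fixed_anti_orth.
      have := h1; rewrite E ike !BE (Bsym e) pP.2 (Bsym q) (fixed_anti_orth pP.1 hq); lra.
    by rewrite E ike p0 scale0r !add0r.
  move=> [[a b] [c d]]; exists a, (b *: i + c *: k + d *: m i k); split.
    by rewrite /anti !rE i_anti hk hik; lmod.
  by rewrite /= !mE !m1l; lmod.
have g_r x : r (g x) = g (Hconj x).
  rewrite (emb_conj gP); have [a [z [hz ->]]] := g_span x.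
  by rewrite /comp_conj !BE (anti_imag hz) (comp_1 A) !rE hz; lmod.
have g_orth x : B (g x) j = 0.
  have [a [z [hz ->]]] := g_span x.
  by rewrite !BE (Bsym e) je Bsym (fixed_anti_orth rj hz); ring.
have g_j x : r (m (g x) j) = m (g x) j.
  have [a [z [hz ->]]] := g_span x; have zj := fixed_anti_orth rj hz.
  rewrite !mE m1l (imag_anticomm je (anti_imag hz) zj) !rE rj.
  by rewrite (fixed_anti_mul j_fixed hz).1.
have hP := emb_double A gP g_orth j1; have h_onto := octonion_onto A hP.
apply: (alg_iso_of_onto (emb_lin hP) (emb_inj hP) h_onto) => p q.
by rewrite mulE rD g_r g_j; exact: (emb_M hP (Hconj p.1, p.2) q).
Qed.

Lemma mixed_classification : degree4_models /\ deg_le mul 4 /\ ~ deg_le mul 2.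
Proof.
split; last by split; [exact: mixed_deg | exact: mixed_not_deg2].
rewrite /degree4_models.
have [line|] := pselect (forall z, anti z -> z = B z i *: i).
  by case: (mixed_line line) => h; [apply: Or41 | apply: Or42].
move=> /existsNP [z /not_implyP [hz nz]]; apply: Or43.
pose k := z - B z i *: i.
have k0 : k <> 0 by move/eqP; rewrite subr_eq0 => /eqP.
have hk : anti k by rewrite /anti /k !rE hz i_anti; lmod.
apply: (@mixed_plane ((Num.sqrt (B k k))^-1 *: k)).
- by rewrite /anti rZ hk scalerN.
- exact: normalize.
- by rewrite BE /k !BE i1; ring.
Qed.


End Mixed.

Lemma isotope_classification :
  (degree2_models /\ deg_le mul 2) \/
  (degree4_models /\ deg_le mul 4 /\ ~ deg_le mul 2).
Proof.
have [no_anti|] := pselect (forall z, anti z -> z = 0).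
  left; apply: pure_fixed => x; have [p [q [[rp _] /no_anti q0 ->]]] := decomposition x.
  by rewrite q0 addr0 !rE rp.
move=> /existsNP [z /not_implyP [hz z0]].
have [no_fixed|] := pselect (forall y, fixed_imag y -> y = 0).
  left; apply: pure_anti => x; have [p [q [/no_fixed p0 hq xE]]] := decomposition x.
  by rewrite /cj /comp_conj {1 3}xE p0 !rE hq; lmod.
move=> /existsNP [y /not_implyP [[ry ye] y0]]; right.
apply: (@mixed_classification ((Num.sqrt (B z z))^-1 *: z) ((Num.sqrt (B y y))^-1 *: y)).
- by rewrite /anti rZ hz scalerN.
- exact: normalize.
- by split; [rewrite rZ ry | rewrite BE ye mulr0].
- exact: normalize.
Qed.

End Isotope.

Theorem theorem5 (R : realType) (V : lmodType R) (mul : V -> V -> V) (nrm : V -> R) :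
  absolute_valued_algebra mul nrm ->
  (exists e : V, left_unit mul e) ->
  (forall x : V, associator mul (mul x x) (mul x x) (mul x x) = 0) ->
  [/\ finite_dimensional V,
      deg_le mul 4,
      deg_le mul 2 ->
        (alg_iso mul (@Rmul R) \/ alg_iso mul (@Cmul R) \/ alg_iso mul (@starCmul R) \/
         alg_iso mul (@Hmul R) \/ alg_iso mul (@starHmul R) \/ alg_iso mul (@Omul R) \/
         alg_iso mul (@starOmul R))
    & deg_eq mul 4 ->
        [\/ alg_iso mul (@starHi1mul R), alg_iso mul (@starOi1mul R),
            alg_iso mul (@Otildemul R) | alg_iso mul (@Otildeimul R)]].
Proof.
move=> algP [e eP] assocP.
have mul_bil := algP.2.1.
have rK := right_unit_involutive algP eP assocP.
have [B [A r_form]] := isotope_composition algP eP assocP.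
(* For the isotope m x y = (x e) y and r y = y e, the term [m (r y) y] unfolds to ((y e) e) y. *)
have r_square y : mul (mul (mul (mul y e) e) y) e = mul (mul (mul y e) e) y.
  by rewrite rK (right_unit_square algP eP assocP).
have mulE x y : mul x y = mul (mul (mul x e) e) y by rewrite rK.
have r_lin a x y : mul (a *: x + y) e = a *: mul x e + mul y e by rewrite !(bilE mul_bil).
have fR := finite_dimensional_real R.
have fC : finite_dimensional (Cc R) by exact: finite_dimensional_prod.
have fH : finite_dimensional (Hh R) by exact: finite_dimensional_prod.
have fO : finite_dimensional (Oo R) by exact: finite_dimensional_prod.
have [[models deg2]|[models [deg4 ndeg2]]] :=
    isotope_classification A mulE r_lin (eP e) rK r_form r_square; split=> //.
- by case: models => [|[|[|[|[|[|]]]]]] /finite_dimensional_iso; apply.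
- move=> x; have [f [fS hf]] := deg2 x.
  (* Two spanning vectors are padded with zeros to a family of four. *)
  apply: (@dim_le_of_span _ _ _ (fun i : 'I_4 => [:: f ord0; f ord_max; 0; 0]`_i)).
  + by move=> S [].
  + by move=> a y z hy hz S SP Sx; apply: SP.2.1; [exact: hy | exact: hz].
  + move=> v /hf [c ->]; exists (fun i : 'I_4 => [:: c ord0; c ord_max; 0; 0]`_i).
    rewrite !big_ord_recl !big_ord0 /= !scaler0 !addr0.
    by congr (_ + c _ *: f _); apply: val_inj.
(* Minimality of the degree would give 4 <= 2. *)
- by move=> [_ /(_ 2 deg2)].
- by case: models => /finite_dimensional_iso; apply.
Qed.
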